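(* For $d\in\mathbb N$ let $\rho_d\in\mathbb R\cup\{+\infty\}$ be the value of the semidefinite program $$\rho_d=\inf\int_{\mathcal Q}v_d(q)\,dq$$ over $v_d\in\mathbb R[q]_{2d}$, $\sigma_0\in\Sigma[q,x,y]_{2d}$, $\sigma_j\in\Sigma[q,x,y]_{2d-2}$ ($j=1,\dots,n$), $\tau_\Re,\tau_\Im\in\mathbb R[q,x,y]_{2d-m}$ subject to the polynomial identity in $\mathbb R[q,x,y]$ $$v_d(q)-x=\sigma_0+\sum_{j=1}^n\sigma_j\,(1-q_j^2)+\tau_\Re\,p_\Re+\tau_\Im\,p_\Im .$$ Let $d_0$ be such that this program is feasible for all $d\ge d_0$, and for each $d\ge d_0$ let $v_d$ be a near optimal solution, i.e. a feasible $v_d$ with $\int_{\mathcal Q}v_d(q)\,dq\le\rho_d+\frac1d$. Then $v_d\ge a$ on $\mathcal Q$ and $v_d$ converges to the abscissa $a$ in $L^1(\mathcal Q)$ norm, i.e. $\lim_{d\to\infty}\int_{\mathcal Q}|v_d(q)-a(q)|\,dq=0$. Moreover $\lim_{d\to\infty}\rho_d=\int_{\mathcal Q}a(q)\,dq$.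
   Context: Let $n\ge1$, $\mathcal Q=[-1,1]^n$, $dq$ Lebesgue measure. Let $m\ge1$ and $p(q,s)=\sum_{k=0}^m p_k(q)s^k$ with $p_k\in\mathbb R[q]$ and $p_m\equiv1$, $s\in\mathbb C$. The abscissa is $a(q)=\max\{\Re(s): p(q,s)=0\}$, $q\in\mathcal Q$. Writing $s=x+iy$, define $p_\Re,p_\Im\in\mathbb R[q,x,y]$ by $p(q,x+iy)=p_\Re(q,x,y)+i\,p_\Im(q,x,y)$. $\mathbb R[z]_k$ denotes real polynomials in the variables $z$ of degree at most $k$, and $\Sigma[z]_{2k}$ the sums of squares of polynomials in $z$ of degree at most $2k$. *)

(* Defs.v *)
From Stdlib Require Import Reals Lra List ZArith ClassicalEpsilon.
Open Scope R_scope.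

Fixpoint sumR (n : nat) (f : nat -> R) : R :=
  match n with O => 0 | S n' => sumR n' f + f n' end.

(* ---------- multivariate real polynomials ----------
   A monomial is (coefficient, exponent list); the exponent list
   [e0; e1; ...] denotes z_0^e0 * z_1^e1 * ... ; a polynomial is a finite
   list of monomials (their sum). Points are z : nat -> R. *)
Definition monomial := (R * list nat)%type.
Definition mpoly := list monomial.

Fixpoint mono_eval (e : list nat) (z : nat -> R) (j : nat) : R :=
  match e with
  | nil => 1
  | k :: e' => (z j) ^ k * mono_eval e' z (S j)
  end.

Definition mp_eval (P : mpoly) (z : nat -> R) : R :=
  fold_right (fun mo acc => fst mo * mono_eval (snd mo) z 0 + acc) 0 P.

(* total degree at most k (k an integer; for k < 0 only the zero polynomial) *)
Definition mp_deg_le (P : mpoly) (k : Z) : Prop :=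
  Forall (fun mo => (Z.of_nat (list_sum (snd mo)) <= k)%Z) P.

Definition mp_vars_lt (P : mpoly) (N : nat) : Prop :=
  Forall (fun mo => (length (snd mo) <= N)%nat) P.

Definition mp_in (N : nat) (k : Z) (P : mpoly) : Prop :=
  mp_vars_lt P N /\ mp_deg_le P k.

(* sums of squares: the list L = [g_1; ...; g_r] denotes sum g_i^2;
   sos_in N k L  means each g_i is in R[z_0..z_(N-1)]_k, i.e. the SOS is in
   Sigma[z]_(2k). *)
Definition sos_eval (L : list mpoly) (z : nat -> R) : R :=
  fold_right (fun P acc => (mp_eval P z) ^ 2 + acc) 0 L.

Definition sos_in (N : nat) (k : Z) (L : list mpoly) : Prop :=
  Forall (mp_in N k) L.

Fixpoint cpow (x y : R) (k : nat) : R * R :=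
  match k with
  | O => (1, 0)
  | S k' => let (a, b) := cpow x y k' in (a * x - b * y, a * y + b * x)
  end.

Definition pRe (m : nat) (pk : nat -> mpoly) (q : nat -> R) (x y : R) : R :=
  sumR (S m) (fun k => mp_eval (pk k) q * fst (cpow x y k)).
Definition pIm (m : nat) (pk : nat -> mpoly) (q : nat -> R) (x y : R) : R :=
  sumR (S m) (fun k => mp_eval (pk k) q * snd (cpow x y k)).

Definition is_root (m : nat) (pk : nat -> mpoly) (q : nat -> R) (x y : R) : Prop :=
  pRe m pk q x y = 0 /\ pIm m pk q x y = 0.

Definition is_abscissa (m : nat) (pk : nat -> mpoly) (q : nat -> R) (r : R) : Prop :=
  (exists y, is_root m pk q r y) /\ (forall x y, is_root m pk q x y -> x <= r).

Definition abscissa (m : nat) (pk : nat -> mpoly) (q : nat -> R) : R :=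
  epsilon (inhabits 0) (is_abscissa m pk q).

Definition in_cube (n : nat) (q : nat -> R) : Prop :=
  forall j, (j < n)%nat -> -1 <= q j <= 1.

(* midpoint Riemann sum over [-1,1]^n with N subintervals per axis
   (the integrated variables are q_0, ..., q_(n-1)) *)
Fixpoint rsum_cube (N n : nat) (f : (nat -> R) -> R) : R :=
  match n with
  | O => f (fun _ => 0)
  | S n' =>
      sumR N (fun i => (2 / INR N) *
        rsum_cube N n' (fun q => f (fun j => match j with
                                             | O => -1 + (2 * INR i + 1) / INR N
                                             | S j' => q j'
                                             end)))
  end.

(* integral over Q w.r.t. Lebesgue measure dq, as limit of Riemann sums
   (coincides with the Lebesgue integral for continuous / Riemann
   integrable integrands, which is the case for all integrands below) *)
Definition cube_int (n : nat) (f : (nat -> R) -> R) : R :=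
  epsilon (inhabits 0) (fun I => Un_cv (fun N => rsum_cube N n f) I).

Definition qxy (n : nat) (q : nat -> R) (x y : R) : nat -> R :=
  fun j => if Nat.ltb j n then q j else if Nat.eqb j n then x else y.

Definition feasible (n m : nat) (pk : nat -> mpoly) (d : nat) (v : mpoly) : Prop :=
  mp_in n (2 * Z.of_nat d) v /\
  exists (s0 : list mpoly) (sj : nat -> list mpoly) (tRe tIm : mpoly),
    sos_in (n + 2) (Z.of_nat d) s0 /\
    (forall j, (j < n)%nat -> sos_in (n + 2) (Z.of_nat d - 1) (sj j)) /\
    mp_in (n + 2) (2 * Z.of_nat d - Z.of_nat m) tRe /\
    mp_in (n + 2) (2 * Z.of_nat d - Z.of_nat m) tIm /\
    forall (q : nat -> R) (x y : R),
      mp_eval v (qxy n q x y) - x =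
        sos_eval s0 (qxy n q x y)
        + sumR n (fun j => sos_eval (sj j) (qxy n q x y) * (1 - (q j) ^ 2))
        + mp_eval tRe (qxy n q x y) * pRe m pk q x y
        + mp_eval tIm (qxy n q x y) * pIm m pk q x y.

Definition is_inf (S : R -> Prop) (r : R) : Prop :=
  (forall s, S s -> r <= s) /\ (forall r', (forall s, S s -> r' <= s) -> r' <= r).

(* Main.v *)
(* [v(q) >= a(q)] holds at every feasible [v] because the right-hand side of the
   certificate is nonnegative at the roots. For the limit it suffices to find,
   for every [eps], a feasible polynomial between [a] and [a + eps].

   The abscissa is uniformly continuous on the cube: [|p(q', s)|] is the product
   of the distances from [s] to the roots of [p(q', .)], so a root [s] of
   [p(q, .)] is close to some root of [p(q', .)] when [q'] is close to [q]. By
   Weierstrass there is a polynomial [w] with [a < w < a + eps] on the cube, and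
   [w - x] is positive on the set [{q in Q, p_Re = p_Im = 0}]. The quadratic
   module of that set is Archimedean: with [r = x^2 + y^2], monicity gives
   [r^m = |sum_(k < m) p_k s^k|^2] modulo the ideal, which bounds [r]. Putinar's
   Positivstellensatz then certifies [w - x].

   Putinar's theorem is proved without Zorn's lemma: a proper quadratic module
   is enlarged by one of [z_j - t], [t - z_j] for every coordinate [j] and every
   rational [t]; these cuts determine a point at which all its elements are
   nonnegative. *)

From mathcomp Require ssreflect ssrfun ssrbool eqtype ssrnat seq fintype bigop.
From mathcomp Require ssralg poly complex Rstruct.
Require Import Defs.
From Stdlib Require Import Reals List ZArith Lra Lia Classical ClassicalEpsilon Cantor.
Import ListNotations.
Open Scope R_scope.

(** Degrees are tracked only at the very end: polynomials are handled as functions, and a fixed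
    certificate meets the degree bounds of the program for every large [d]. A quadratic module is
    not closed under products. Wherever a product is wanted, an identity with square multipliers
    stands in for it: this is the pattern behind most of the algebra below. Cutting by countably
    many rationals does not produce a maximal module. In the limit module a polynomial [f] agrees
    with its value [f c] only up to arbitrarily small constants; this suffices because a constant in
    a proper module is nonnegative, and the Archimedean bounds keep such errors small under
    multiplication. Refuting [-f >= 0] yields only [f t = 1 + s] with [t] a sum of squares. As [t]
    cannot be divided out, [f + r] is certified for decreasing constants [r] until [r <= 0]. *)

Definition fn := (nat -> R) -> R.

(** * Polynomial functions *)

Fixpoint exp_add (e e' : list nat) : list nat :=
  match e, e' with
  | nil, _ => e'
  | _, nil => e
  | a :: l, b :: l' => (a + b)%nat :: exp_add l l'
  end.

Definition mp_mul (P Q : mpoly) : mpoly :=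
  flat_map (fun mo => map (fun mo' => (fst mo * fst mo', exp_add (snd mo) (snd mo'))) Q) P.

Lemma mono_eval_exp_add (e e' : list nat) (z : nat -> R) (j : nat) :
  mono_eval (exp_add e e') z j = mono_eval e z j * mono_eval e' z j.
Proof.
  revert e' j; induction e as [|a e IH]; intros [|b e'] j; simpl; try ring.
  rewrite IH, pow_add; ring.
Qed.

Lemma length_exp_add (e e' : list nat) (N : nat) :
  (length e <= N -> length e' <= N -> length (exp_add e e') <= N)%nat.
Proof.
  revert e' N; induction e as [|a e IH]; intros [|b e'] N; simpl; intros; try lia.
  destruct N as [|N]; [lia|].
  specialize (IH e' N); lia.
Qed.

Lemma mp_eval_app (P Q : mpoly) (z : nat -> R) :
  mp_eval (P ++ Q) z = mp_eval P z + mp_eval Q z.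
Proof.
  unfold mp_eval; induction P as [|mo P IH]; simpl; [ring|rewrite IH; ring].
Qed.

Lemma mp_eval_mul (P Q : mpoly) (z : nat -> R) :
  mp_eval (mp_mul P Q) z = mp_eval P z * mp_eval Q z.
Proof.
  induction P as [|mo P IH]; [unfold mp_eval; simpl; ring|].
  unfold mp_mul; simpl; rewrite mp_eval_app.
  fold (mp_mul P Q); rewrite IH.
  assert (H : mp_eval (map (fun mo' => (fst mo * fst mo', exp_add (snd mo) (snd mo'))) Q) z
              = fst mo * mono_eval (snd mo) z 0 * mp_eval Q z).
  { clear; induction Q as [|mo' Q IH]; unfold mp_eval in *; simpl; [ring|].
    rewrite IH, mono_eval_exp_add; ring. }
  rewrite H; unfold mp_eval; simpl; ring.
Qed.

Lemma mp_vars_lt_mul (N : nat) (P Q : mpoly) :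
  mp_vars_lt P N -> mp_vars_lt Q N -> mp_vars_lt (mp_mul P Q) N.
Proof.
  unfold mp_vars_lt; rewrite !Forall_forall; intros HP HQ mo Hmo.
  apply in_flat_map in Hmo as (a & Ha & Hmo).
  apply in_map_iff in Hmo as (b & <- & Hb); simpl.
  apply length_exp_add; [exact (HP a Ha) | exact (HQ b Hb)].
Qed.

Lemma mono_eval_ext (e : list nat) (z z' : nat -> R) (i : nat) :
  (forall j, (i <= j < i + length e)%nat -> z j = z' j) ->
  mono_eval e z i = mono_eval e z' i.
Proof.
  revert i; induction e as [|a e IH]; intros i H; simpl in *; [reflexivity|].
  rewrite (H i) by lia; rewrite (IH (S i)); [reflexivity|].
  intros j Hj; apply H; lia.
Qed.

Lemma mp_eval_ext (N : nat) (P : mpoly) (z z' : nat -> R) :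
  mp_vars_lt P N -> (forall j, (j < N)%nat -> z j = z' j) -> mp_eval P z = mp_eval P z'.
Proof.
  intros HP Hz; unfold mp_eval; induction HP as [|mo P Hmo HP IH]; simpl; [reflexivity|].
  rewrite IH; f_equal; f_equal; apply mono_eval_ext; intros j Hj; apply Hz; lia.
Qed.

(** Many lists denote the same polynomial; passing to functions lets identities be checked pointwise
    by [ring]. *)
Definition is_poly (N : nat) (f : fn) : Prop :=
  exists P, mp_vars_lt P N /\ forall z, f z = mp_eval P z.

Lemma is_poly_ext (N : nat) (f g : fn) :
  (forall z, f z = g z) -> is_poly N f -> is_poly N g.
Proof.
  intros E (P & HP & HfP); exists P; split; [exact HP|].
  intro z; rewrite <- E; apply HfP.
Qed.

Lemma is_poly_mp_eval (N : nat) (P : mpoly) : mp_vars_lt P N -> is_poly N (mp_eval P).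
Proof. intro HP; exists P; split; [exact HP|reflexivity]. Qed.

Lemma is_poly_const (N : nat) (c : R) : is_poly N (fun _ => c).
Proof.
  exists ((c, nil) :: nil); split; [constructor; [simpl; lia|constructor]|].
  intro z; unfold mp_eval; simpl; ring.
Qed.

Lemma is_poly_add (N : nat) (f g : fn) :
  is_poly N f -> is_poly N g -> is_poly N (fun z => f z + g z).
Proof.
  intros (P & HP & HfP) (Q & HQ & HgQ); exists (P ++ Q); split.
  - apply Forall_app; split; assumption.
  - intro z; rewrite mp_eval_app, HfP, HgQ; reflexivity.
Qed.

Lemma is_poly_mul (N : nat) (f g : fn) :
  is_poly N f -> is_poly N g -> is_poly N (fun z => f z * g z).
Proof.
  intros (P & HP & HfP) (Q & HQ & HgQ); exists (mp_mul P Q); split.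
  - apply mp_vars_lt_mul; assumption.
  - intro z; rewrite mp_eval_mul, HfP, HgQ; reflexivity.
Qed.

Lemma is_poly_opp (N : nat) (f : fn) : is_poly N f -> is_poly N (fun z => - f z).
Proof.
  intro Hf; apply is_poly_ext with (fun z => (-1) * f z); [intro; ring|].
  apply is_poly_mul; [apply is_poly_const|exact Hf].
Qed.

Lemma is_poly_sub (N : nat) (f g : fn) :
  is_poly N f -> is_poly N g -> is_poly N (fun z => f z - g z).
Proof.
  intros Hf Hg; apply is_poly_add; [exact Hf|apply is_poly_opp, Hg].
Qed.

Lemma is_poly_pow (N : nat) (f : fn) (k : nat) : is_poly N f -> is_poly N (fun z => f z ^ k).
Proof.
  intro Hf; induction k as [|k IH]; simpl; [apply is_poly_const|apply is_poly_mul; assumption].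
Qed.

Lemma is_poly_sumR (N k : nat) (f : nat -> fn) :
  (forall i, (i < k)%nat -> is_poly N (f i)) -> is_poly N (fun z => sumR k (fun i => f i z)).
Proof.
  intro Hf; induction k as [|k IH]; simpl; [apply is_poly_const|].
  apply is_poly_add; [apply IH; intros; apply Hf; lia|apply Hf; lia].
Qed.

Lemma mono_eval_nth_unit (j i : nat) (z : nat -> R) :
  mono_eval (repeat 0%nat j ++ 1%nat :: nil) z i = z (i + j)%nat.
Proof.
  revert i; induction j as [|j IH]; intro i; simpl.
  - rewrite Nat.add_0_r; ring.
  - rewrite IH; replace (S i + j)%nat with (i + S j)%nat by lia; ring.
Qed.

Lemma is_poly_coord (N j : nat) : (j < N)%nat -> is_poly N (fun z => z j).
Proof.
  intro Hj; exists ((1, repeat 0%nat j ++ 1%nat :: nil) :: nil); split.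
  - constructor; [|constructor]; simpl; rewrite length_app, repeat_length; simpl; lia.
  - intro z; unfold mp_eval; simpl; rewrite mono_eval_nth_unit; simpl; ring.
Qed.

Lemma mono_eval_shift (e : list nat) (z : nat -> R) (i : nat) :
  mono_eval e (fun j => z (S j)) i = mono_eval e z (S i).
Proof.
  revert i; induction e as [|a e IH]; intro i; simpl; [reflexivity|rewrite IH; reflexivity].
Qed.

Lemma is_poly_shift (N : nat) (f : fn) :
  is_poly N f -> is_poly (S N) (fun z => f (fun j => z (S j))).
Proof.
  intros (P & HP & HfP).
  exists (map (fun mo => (fst mo, 0%nat :: snd mo)) P); split.
  - apply Forall_map; eapply Forall_impl; [|exact HP]; simpl; intros; lia.
  - intro z; rewrite HfP; clear; unfold mp_eval.
    induction P as [|mo P IH]; simpl; [reflexivity|].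
    rewrite IH, mono_eval_shift; ring.
Qed.

(** The first premise stands in for functional extensionality. *)
Lemma is_poly_ind (N : nat) (Q : fn -> Prop) :
  (forall f g, (forall z, f z = g z) -> Q f -> Q g) ->
  (forall c, Q (fun _ => c)) ->
  (forall j, (j < N)%nat -> Q (fun z => z j)) ->
  (forall f g, Q f -> Q g -> Q (fun z => f z + g z)) ->
  (forall f g, Q f -> Q g -> Q (fun z => f z * g z)) ->
  forall f, is_poly N f -> Q f.
Proof.
  intros Qext Qc Qv Qa Qm f (P & HP & HfP).
  apply Qext with (mp_eval P); [intro; symmetry; apply HfP|]; clear f HfP.
  assert (Qpow : forall f k, Q f -> Q (fun z => f z ^ k)).
  { intros f k Hf; induction k as [|k IH]; simpl; [apply Qc|exact (Qm _ _ Hf IH)]. }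
  assert (Qmono : forall e i, (i + length e <= N)%nat -> Q (fun z => mono_eval e z i)).
  { induction e as [|a e IH]; intros i Hi; simpl in *; [apply Qc|].
    apply (Qm (fun z => z i ^ a) (fun z => mono_eval e z (S i))).
    - apply (Qpow (fun z => z i)), Qv; lia.
    - apply IH; lia. }
  induction HP as [|mo P Hmo HP IH]; [exact (Qc 0)|].
  apply (Qa (fun z => fst mo * mono_eval (snd mo) z 0) (mp_eval P)); [|exact IH].
  apply (Qm (fun _ => fst mo) (fun z => mono_eval (snd mo) z 0)); [apply Qc|].
  apply Qmono; simpl; exact Hmo.
Qed.

(** * Quadratic modules and Putinar's Positivstellensatz *)

(** A sum of squares multiplying a generator is spread over several summands [a ^ 2 * g]. Both
    equations are pointwise, so membership respects pointwise equality. *)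
Inductive qmod (N : nat) (G : fn -> Prop) : fn -> Prop :=
| qmod_gen a g f : is_poly N a -> G g -> (forall z, f z = a z ^ 2 * g z) -> qmod N G f
| qmod_sum f g h : qmod N G f -> qmod N G g -> (forall z, h z = f z + g z) -> qmod N G h.

Definition has_one (G : fn -> Prop) : Prop := G (fun _ => 1).
Definition sos (N : nat) : fn -> Prop := qmod N (eq (fun _ => 1)).
Definition adjoin (G : fn -> Prop) (a : fn) : fn -> Prop := fun g => G g \/ g = a.
Definition proper (N : nat) (G : fn -> Prop) : Prop := ~ qmod N G (fun _ => -1).
(** More often stated as a bound on the sum of the [z_j ^ 2] alone; the bound on every polynomial is
    the form used below. *)
Definition archimedean (N : nat) (G : fn -> Prop) : Prop :=
  forall h, is_poly N h -> exists C, qmod N G (fun z => C - h z).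

Lemma qmod_mono (N : nat) (G G' : fn -> Prop) (f : fn) :
  (forall g, G g -> G' g) -> qmod N G f -> qmod N G' f.
Proof.
  intro HG; induction 1 as [a g f Ha Hg E|f g h _ IHf _ IHg E].
  - apply qmod_gen with a g; auto.
  - apply qmod_sum with f g; auto.
Qed.

Lemma qmod_nonneg (N : nat) (G : fn -> Prop) (f : fn) (z : nat -> R) :
  (forall g, G g -> 0 <= g z) -> qmod N G f -> 0 <= f z.
Proof.
  intro HG; induction 1 as [a g f Ha Hg E|f g h _ IHf _ IHg E]; rewrite E.
  - apply Rmult_le_pos; [apply pow2_ge_0|auto].
  - lra.
Qed.

Section QuadraticModule.
Context (N : nat) (G : fn -> Prop) (G1 : has_one G).
Local Notation M := (qmod N G).

Lemma qmod_sq (a : fn) : is_poly N a -> M (fun z => a z ^ 2).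
Proof.
  intro Ha; apply qmod_gen with a (fun _ => 1); [exact Ha|exact G1|intro; ring].
Qed.

Lemma qmod_const (c : R) : 0 <= c -> M (fun _ => c).
Proof.
  intro Hc; apply qmod_gen with (fun _ => sqrt c) (fun _ => 1); [apply is_poly_const|exact G1|].
  intro; rewrite pow2_sqrt by exact Hc; ring.
Qed.

Lemma qmod_ext (f g : fn) : (forall z, f z = g z) -> M f -> M g.
Proof.
  intros E Hf; apply qmod_sum with f (fun _ => 0); [exact Hf|apply qmod_const; lra|].
  intro; rewrite E; ring.
Qed.

Lemma qmod_add (f g : fn) : M f -> M g -> M (fun z => f z + g z).
Proof. intros Hf Hg; apply qmod_sum with f g; auto. Qed.

Lemma qmod_sq_mul (a f : fn) : is_poly N a -> M f -> M (fun z => a z ^ 2 * f z).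
Proof.
  intros Ha Hf; induction Hf as [b g f Hb Hg E|f g h _ IHf _ IHg E].
  - apply qmod_gen with (fun z => a z * b z) g; [apply is_poly_mul; assumption|exact Hg|].
    intro; rewrite E; ring.
  - eapply qmod_sum; [exact IHf|exact IHg|intro; simpl; rewrite E; ring].
Qed.

Lemma qmod_scale (c : R) (f : fn) : 0 <= c -> M f -> M (fun z => c * f z).
Proof.
  intros Hc Hf; apply qmod_ext with (fun z => sqrt c ^ 2 * f z).
  - intro; rewrite pow2_sqrt by exact Hc; reflexivity.
  - apply (qmod_sq_mul (fun _ => sqrt c)); [apply is_poly_const|exact Hf].
Qed.

Lemma qmod_sos_mul (t f : fn) : sos N t -> M f -> M (fun z => t z * f z).
Proof.
  intros Ht Hf; induction Ht as [a g t Ha Hg E|t u h _ IHt _ IHu E].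
  - apply qmod_ext with (fun z => a z ^ 2 * f z).
    + intro; rewrite E, <- Hg; ring.
    + apply qmod_sq_mul; assumption.
  - eapply qmod_sum; [exact IHt|exact IHu|intro; simpl; rewrite E; ring].
Qed.

Lemma qmod_of_sos (t : fn) : sos N t -> M t.
Proof. apply qmod_mono; intros g <-; exact G1. Qed.

Lemma sos_is_poly (t : fn) : sos N t -> is_poly N t.
Proof.
  induction 1 as [a g t Ha Hg E|t u h _ IHt _ IHu E].
  - apply is_poly_ext with (fun z => a z ^ 2); [intro; rewrite E, <- Hg; ring|].
    apply is_poly_pow; exact Ha.
  - apply is_poly_ext with (fun z => t z + u z); [intro; rewrite E; ring|].
    apply is_poly_add; assumption.
Qed.

Lemma qmod_adjoin (a f : fn) :
  qmod N (adjoin G a) f ->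
  exists s t, M s /\ sos N t /\ forall z, f z = s z + t z * a z.
Proof.
  assert (S0 : sos N (fun _ => 0)).
  { apply qmod_gen with (fun _ => 0) (fun _ => 1); [apply is_poly_const|reflexivity|intro; ring]. }
  induction 1 as [b g f Hb [Hg|Hg] E|f g h _ (s & t & Hs & Ht & Ef) _ (s' & t' & Hs' & Ht' & Eg) E].
  - exists f, (fun _ => 0); split; [apply qmod_gen with b g; auto|split; [exact S0|intro; ring]].
  - exists (fun _ => 0), (fun z => b z ^ 2); split; [apply qmod_const; lra|split].
    + apply qmod_gen with b (fun _ => 1); [exact Hb|reflexivity|intro; ring].
    + intro; rewrite E, Hg; ring.
  - exists (fun z => s z + s' z), (fun z => t z + t' z); split; [|split].
    + apply qmod_add; assumption.
    + apply qmod_sum with t t'; auto.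
    + intro; rewrite E, Ef, Eg; ring.
Qed.

(** The support of [M], i.e. the [t] with both [t] and [- t] in [M], is an ideal because [a = ((a +
    1) / 2) ^ 2 - ((a - 1) / 2) ^ 2]. *)
Lemma qmod_support_mul (t a : fn) :
  M t -> M (fun z => - t z) -> is_poly N a -> M (fun z => t z * a z).
Proof.
  intros Ht Ht' Ha.
  apply qmod_sum with (fun z => ((1 / 2) * (a z + 1)) ^ 2 * t z)
                      (fun z => ((1 / 2) * (a z - 1)) ^ 2 * (- t z)); [| |intro; field].
  - apply (qmod_sq_mul (fun z => (1 / 2) * (a z + 1))); [|exact Ht].
    apply is_poly_mul; [apply is_poly_const|apply is_poly_add; [exact Ha|apply is_poly_const]].
  - apply (qmod_sq_mul (fun z => (1 / 2) * (a z - 1)) (fun z => - t z)); [|exact Ht'].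
    apply is_poly_mul; [apply is_poly_const|apply is_poly_sub; [exact Ha|apply is_poly_const]].
Qed.

(** If both extensions contained [-1], say [-1 = s + t a = s' - t' a], eliminating [a] would give
    [- t = t' s + t s' + t']. Then [t] is in the support, hence [t a] and [-1 = s + t a] are in
    [M]. *)
Lemma proper_adjoin (a : fn) :
  is_poly N a -> proper N G -> ~ proper N (adjoin G a) -> proper N (adjoin G (fun z => - a z)).
Proof.
  intros Ha HG Hna Hna'; apply NNPP in Hna.
  apply qmod_adjoin in Hna as (s & t & Hs & Ht & E).
  apply qmod_adjoin in Hna' as (s' & t' & Hs' & Ht' & E').
  apply HG, qmod_sum with s (fun z => t z * a z); [exact Hs| |exact E].
  apply qmod_support_mul; [apply qmod_of_sos, Ht| |exact Ha].
  apply qmod_sum with (fun z => t' z * s z + t z * s' z) t'.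
  - apply qmod_add; apply qmod_sos_mul; assumption.
  - apply qmod_of_sos, Ht'.
  - intro z; specialize (E z); specialize (E' z).
    replace (s z) with (-1 - t z * a z) by lra.
    replace (s' z) with (-1 + t' z * a z) by lra.
    ring.
Qed.

Lemma proper_const_nonneg (c : R) : proper N G -> M (fun _ => c) -> 0 <= c.
Proof.
  intros HG Hc; destruct (Rle_or_lt 0 c) as [H|H]; [exact H|exfalso].
  apply HG, qmod_ext with (fun z => / (- c) * c); [intro; field; lra|].
  apply (qmod_scale _ (fun _ => c)); [|exact Hc].
  apply Rlt_le, Rinv_0_lt_compat; lra.
Qed.

(** Membership in the support up to every positive constant: the substitute for vanishing at the
    point that [M] determines. *)
Definition infinitesimal (b : fn) : Prop :=
  forall eps, 0 < eps -> M (fun z => eps - b z) /\ M (fun z => eps + b z).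

(** The product [(eps - b) (eps + b)] is reached by giving each factor the square of the other as
    multiplier; the two terms add up to [2 eps] times the product. *)
Lemma qmod_sq_sub (eps : R) (b : fn) : 0 < eps -> is_poly N b ->
  M (fun z => eps - b z) -> M (fun z => eps + b z) -> M (fun z => eps ^ 2 - b z ^ 2).
Proof.
  intros Heps Hb H1 H2.
  apply qmod_ext with
    (fun z => / (2 * eps) * ((eps - b z) ^ 2 * (eps + b z) + (eps + b z) ^ 2 * (eps - b z))).
  { intro; field; lra. }
  apply (qmod_scale _ (fun z => (eps - b z) ^ 2 * (eps + b z) + (eps + b z) ^ 2 * (eps - b z))).
  { apply Rlt_le, Rinv_0_lt_compat; lra. }
  apply (qmod_add (fun z => (eps - b z) ^ 2 * (eps + b z))
                  (fun z => (eps + b z) ^ 2 * (eps - b z))).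
  - apply (qmod_sq_mul (fun z => eps - b z) (fun z => eps + b z)); [|exact H2].
    apply is_poly_sub; [apply is_poly_const|exact Hb].
  - apply (qmod_sq_mul (fun z => eps + b z) (fun z => eps - b z)); [|exact H1].
    apply is_poly_add; [apply is_poly_const|exact Hb].
Qed.

Lemma infinitesimal_ext (b b' : fn) :
  (forall z, b z = b' z) -> infinitesimal b -> infinitesimal b'.
Proof.
  intros E Hb eps Heps; destruct (Hb eps Heps) as [H1 H2]; split.
  - eapply qmod_ext; [|exact H1]; intro; simpl; rewrite E; reflexivity.
  - eapply qmod_ext; [|exact H2]; intro; simpl; rewrite E; reflexivity.
Qed.

Lemma infinitesimal_add (b b' : fn) :
  infinitesimal b -> infinitesimal b' -> infinitesimal (fun z => b z + b' z).
Proof.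
  intros Hb Hb' eps Heps.
  destruct (Hb (eps / 2)) as [H1 H2]; [lra|].
  destruct (Hb' (eps / 2)) as [H1' H2']; [lra|].
  split; [eapply qmod_sum; [exact H1|exact H1'|intro; simpl; field]
         |eapply qmod_sum; [exact H2|exact H2'|intro; simpl; field]].
Qed.

Lemma infinitesimal_mul (b h : fn) : archimedean N G ->
  is_poly N b -> is_poly N h -> infinitesimal b -> infinitesimal (fun z => b z * h z).
Proof.
  intros HA Hb Hh Hinf.
  destruct (HA (fun z => h z ^ 2)) as [C HC]; [apply is_poly_pow, Hh|].
  set (K := 1 + Rabs C).
  assert (HK : 0 < K) by (unfold K; pose proof (Rabs_pos C); lra).
  assert (HKh : M (fun z => K ^ 2 - h z ^ 2)).
  { apply qmod_sum with (fun _ => K ^ 2 - C) (fun z => C - h z ^ 2); [|exact HC|intro; ring].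
    apply qmod_const; unfold K; pose proof (Rle_abs C); pose proof (Rabs_pos C); nra. }
  assert (main : forall s, s ^ 2 = 1 -> forall eps, 0 < eps -> M (fun z => eps + s * (b z * h z))).
  (* Inequality of arithmetic and geometric means with weight [w]: this choice makes both error
     terms, [(eps / K) ^ 2 / (2 w)] and [w K ^ 2 / 2], equal to [eps / 2]. *)
  { intros s Hs eps Heps; set (w := eps / K ^ 2).
    assert (HK2 : 0 < K ^ 2) by (apply pow_lt; exact HK).
    assert (Hw : 0 < w) by (apply Rdiv_lt_0_compat; assumption).
    assert (Hw' : 0 <= / (2 * w)) by (apply Rlt_le, Rinv_0_lt_compat; lra).
    apply qmod_sum with (fun z => / (2 * w) * (b z + s * w * h z) ^ 2)
      (fun z => / (2 * w) * ((eps / K) ^ 2 - b z ^ 2) + w / 2 * (K ^ 2 - h z ^ 2)).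
    - apply (qmod_scale _ (fun z => (b z + s * w * h z) ^ 2)); [exact Hw'|].
      apply (qmod_sq (fun z => b z + s * w * h z)), is_poly_add; [exact Hb|].
      apply is_poly_mul; [apply is_poly_const|exact Hh].
    - apply qmod_add.
      + apply (qmod_scale _ (fun z => (eps / K) ^ 2 - b z ^ 2)); [exact Hw'|].
        assert (He : 0 < eps / K) by (apply Rdiv_lt_0_compat; assumption).
        destruct (Hinf _ He); apply qmod_sq_sub; assumption.
      + apply (qmod_scale _ (fun z => K ^ 2 - h z ^ 2)); [lra|exact HKh].
    - intro z; replace ((b z + s * w * h z) ^ 2)
        with (b z ^ 2 + 2 * s * w * b z * h z + s ^ 2 * w ^ 2 * h z ^ 2) by ring.
      rewrite Hs; unfold w; field; lra. }
  intros eps Heps; split.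
  - eapply qmod_ext; [|apply (main (-1)); [ring|exact Heps]]; intro; simpl; ring.
  - eapply qmod_ext; [|apply (main 1); [ring|exact Heps]]; intro; simpl; ring.
Qed.

Lemma infinitesimal_at_point (c : nat -> R) : archimedean N G ->
  (forall j, (j < N)%nat -> infinitesimal (fun z => z j - c j)) ->
  forall f, is_poly N f -> infinitesimal (fun z => f z - f c).
Proof.
  intros HA Hc f Hf.
  (* The product case needs both factors to be polynomials, so the induction carries this along. *)
  cut (is_poly N f /\ infinitesimal (fun z => f z - f c)); [tauto|]; revert f Hf.
  apply is_poly_ind.
  - intros f g E [Hf If]; split; [eapply is_poly_ext; eassumption|].
    eapply infinitesimal_ext; [|exact If]; intro; simpl; rewrite !E; reflexivity.
  - intro k; split; [apply is_poly_const|].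
    intros eps Heps; split; apply qmod_ext with (fun _ => eps); try (intro; ring);
      apply qmod_const; lra.
  - intros j Hj; split; [apply is_poly_coord; exact Hj|apply Hc, Hj].
  - intros f g [Hf If] [Hg Ig]; split; [apply is_poly_add; assumption|].
    eapply infinitesimal_ext; [|apply (infinitesimal_add _ _ If Ig)]; intro; simpl; ring.
  - intros f g [Hf If] [Hg Ig]; split; [apply is_poly_mul; assumption|].
    apply infinitesimal_ext with (fun z => (f z - f c) * g z + (g z - g c) * f c);
      [intro; ring|].
    apply infinitesimal_add; apply infinitesimal_mul; try assumption;
      try (apply is_poly_sub; [assumption|]); apply is_poly_const.
Qed.

End QuadraticModule.

(** * Rational cuts and the point that they determine *)

Lemma rational_between (u w : R) : u < w ->
  exists a b c : nat, u < (INR a - INR b) / INR (S c) < w.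
Proof.
  intro Huw; destruct (archimed (/ (w - u))) as [Hc _].
  assert (Hpos : 0 < / (w - u)) by (apply Rinv_0_lt_compat; lra).
  set (c := Z.to_nat (up (/ (w - u)))).
  assert (HSc : / (w - u) < INR (S c)).
  { unfold c; rewrite S_INR, INR_IZR_INZ, Z2Nat.id; [lra|].
    apply le_IZR; lra. }
  assert (HS : 1 < (w - u) * INR (S c)).
  { replace 1 with ((w - u) * / (w - u)) by (field; lra).
    apply Rmult_lt_compat_l; lra. }
  assert (HS0 : 0 < INR (S c)) by lra.
  destruct (archimed (u * INR (S c))) as [Hk1 Hk2]; set (k := up (u * INR (S c))) in *.
  exists (Z.to_nat k), (Z.to_nat (- k)), c.
  assert (E : INR (Z.to_nat k) - INR (Z.to_nat (- k)) = IZR k).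
  { rewrite !INR_IZR_INZ, <- minus_IZR; f_equal; lia. }
  rewrite E; split; apply (Rmult_lt_reg_r (INR (S c))); try exact HS0;
    replace (IZR k / INR (S c) * INR (S c)) with (IZR k) by (field; lra); lra.
Qed.

(* An enumeration of all the [z_j - r] with [j < N] and [r] rational. *)
Definition coord_cut (N k : nat) : fn :=
  let (j, k') := of_nat k in
  let (i, c) := of_nat k' in
  let (a, b) := of_nat i in
  if Nat.ltb j N then fun z => z j - (INR a - INR b) / INR (S c) else fun _ => 0.

Lemma coord_cut_is_poly (N k : nat) : is_poly N (coord_cut N k).
Proof.
  unfold coord_cut; destruct (of_nat k) as [j k'], (of_nat k') as [i c], (of_nat i) as [a b].
  destruct (Nat.ltb_spec j N); [|apply is_poly_const].
  apply is_poly_sub; [apply is_poly_coord; assumption|apply is_poly_const].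
Qed.

Lemma coord_cut_surj (N j a b c : nat) : (j < N)%nat ->
  exists k, coord_cut N k = fun z => z j - (INR a - INR b) / INR (S c).
Proof.
  intro Hj; exists (to_nat (j, to_nat (to_nat (a, b), c))).
  unfold coord_cut; rewrite !cancel_of_to; apply Nat.ltb_lt in Hj; rewrite Hj; reflexivity.
Qed.

(** The choice of sign is recorded inside the predicate, so that properness, which is undecidable,
    is never branched on by a function. *)
Fixpoint cut_chain (N : nat) (G : fn -> Prop) (k : nat) : fn -> Prop :=
  match k with
  | O => G
  | S k' => fun g =>
      cut_chain N G k' g
      \/ (g = coord_cut N k' /\ proper N (adjoin (cut_chain N G k') (coord_cut N k')))
      \/ (g = (fun z => - coord_cut N k' z)
          /\ ~ proper N (adjoin (cut_chain N G k') (coord_cut N k')))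
  end.

Definition cut_limit (N : nat) (G : fn -> Prop) : fn -> Prop :=
  fun g => exists k, cut_chain N G k g.

Lemma cut_chain_le (N : nat) (G : fn -> Prop) (k l : nat) (g : fn) :
  (k <= l)%nat -> cut_chain N G k g -> cut_chain N G l g.
Proof. induction 1; simpl; auto. Qed.

Lemma cut_chain_proper (N : nat) (G : fn -> Prop) (k : nat) :
  has_one G -> proper N G -> proper N (cut_chain N G k).
Proof.
  intros G1 HG; induction k as [|k IH]; [exact HG|].
  assert (C1 : has_one (cut_chain N G k)) by (apply (cut_chain_le N G 0); [lia|exact G1]).
  intro H; destruct (classic (proper N (adjoin (cut_chain N G k) (coord_cut N k)))) as [Hp|Hp].
  - apply Hp; eapply qmod_mono; [|exact H].
    intros g [Hg|[[Hg _]|[_ Hg]]]; [left; exact Hg|right; exact Hg|contradiction].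
  - apply (proper_adjoin N _ C1 _ (coord_cut_is_poly N k) IH Hp).
    eapply qmod_mono; [|exact H].
    intros g [Hg|[[_ Hg]|[Hg _]]]; [left; exact Hg|contradiction|right; exact Hg].
Qed.

(** A certificate uses finitely many generators, hence lives at a finite stage; this is how
    properness passes to the limit. *)
Lemma qmod_cut_limit (N : nat) (G : fn -> Prop) (f : fn) :
  qmod N (cut_limit N G) f -> exists k, qmod N (cut_chain N G k) f.
Proof.
  induction 1 as [a g f Ha [k Hk] E|f g h _ [k IHf] _ [l IHg] E].
  - exists k; apply qmod_gen with a g; assumption.
  - exists (k + l)%nat; apply qmod_sum with f g; [| |exact E];
      (eapply qmod_mono; [|eassumption]); intro g'; apply cut_chain_le; lia.
Qed.

Lemma cut_limit_total (N : nat) (G : fn -> Prop) (k : nat) :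
  cut_limit N G (coord_cut N k) \/ cut_limit N G (fun z => - coord_cut N k z).
Proof.
  destruct (classic (proper N (adjoin (cut_chain N G k) (coord_cut N k)))) as [Hp|Hp];
    [left|right]; exists (S k); simpl; tauto.
Qed.

Lemma archimedean_mono (N : nat) (G G' : fn -> Prop) :
  (forall g, G g -> G' g) -> archimedean N G -> archimedean N G'.
Proof.
  intros HG HA h Hh; destruct (HA h Hh) as [C HC]; exists C; eapply qmod_mono; eassumption.
Qed.

Lemma proper_has_point (N : nat) (G : fn -> Prop) :
  has_one G -> (forall g, G g -> is_poly N g) -> archimedean N G -> proper N G ->
  exists c : nat -> R, forall g, G g -> 0 <= g c.
Proof.
  intros G1 Gpoly HA HG; set (L := cut_limit N G).
  assert (HGL : forall g, G g -> L g) by (intros g Hg; exists 0%nat; exact Hg).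
  assert (L1 : has_one L) by (apply HGL; exact G1).
  assert (LA : archimedean N L) by (eapply archimedean_mono; eassumption).
  assert (HL : proper N L).
  { intro H; apply qmod_cut_limit in H as [k Hk]; revert Hk; apply cut_chain_proper; assumption. }
  assert (Hc : forall j, exists c, (j < N)%nat -> infinitesimal N L (fun z => z j - c)).
  { intro j; destruct (classic (j < N)%nat) as [Hj|Hj]; [|exists 0; contradiction].
    pose proof (is_poly_coord N j Hj) as Pj.
    destruct (LA _ Pj) as [C HC].
    destruct (LA _ (is_poly_opp _ _ Pj)) as [D HD].
    (* The [j]-th coordinate is the supremum of the certified lower bounds of [z_j]. The bound [C]
       on [z_j] keeps the set bounded, the bound [D] on [- z_j] makes it inhabited. *)
    destruct (completeness (fun r => qmod N L (fun z => z j - r))) as [c [Hub Hlub]].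
    - exists C; intros r Hr.
      cut (0 <= C - r); [lra|]; apply (proper_const_nonneg N L L1 _ HL).
      eapply qmod_sum; [exact HC|exact Hr|intro; simpl; ring].
    - exists (- D); eapply qmod_ext; [exact L1| |exact HD]; intro; simpl; ring.
    - exists c; intros _ eps Heps; split.
      (* A rational [r] just above the supremum is not a certified lower bound, so the cut chosen at
         [r] must have been [r - z_j]. *)
      + destruct (rational_between c (c + eps)) as (a & b & d & Hr); [lra|].
        destruct (coord_cut_surj N j a b d Hj) as [k Hk].
        set (r := (INR a - INR b) / INR (S d)) in *.
        destruct (cut_limit_total N G k) as [H|H]; rewrite Hk in H.
        * exfalso; cut (r <= c); [lra|]; apply Hub.
          eapply qmod_gen; [apply (is_poly_const N 1)|exact H|intro; simpl; ring].
        * apply qmod_sum with (fun z => - (z j - r)) (fun _ => c + eps - r);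
            [|apply qmod_const; [exact L1|lra]|intro; ring].
          eapply qmod_gen; [apply (is_poly_const N 1)|exact H|intro; simpl; ring].
      + assert (Hr : exists r, c - eps < r /\ qmod N L (fun z => z j - r)).
        { apply NNPP; intro Hno; cut (c <= c - eps); [lra|].
          apply Hlub; intros r Hr; apply Rnot_lt_le; intro Hlt; apply Hno; exists r; auto. }
        destruct Hr as (r & Hr & Hrq).
        apply qmod_sum with (fun z => z j - r) (fun _ => r - c + eps);
          [exact Hrq|apply qmod_const; [exact L1|lra]|intro; ring]. }
  set (c := fun j => proj1_sig (constructive_indefinite_description _ (Hc j))).
  assert (Hinf : forall j, (j < N)%nat -> infinitesimal N L (fun z => z j - c j))
    by (intro j; exact (proj2_sig (constructive_indefinite_description _ (Hc j)))).
  exists c; intros g Hg; apply Rnot_lt_le; intro Hlt.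
  (* With [eps = - g c / 2], adding [g] to [eps - (g - g c)] leaves the constant [g c / 2], negative
     by assumption, in a proper module. *)
  destruct (infinitesimal_at_point N L L1 c LA Hinf g (Gpoly g Hg) (- g c / 2)) as [H _]; [lra|].
  cut (0 <= g c / 2); [lra|]; apply (proper_const_nonneg N L L1 _ HL).
  apply qmod_sum with (fun z => - g c / 2 - (g z - g c)) g; [exact H| |intro; field].
  apply qmod_gen with (fun _ => 1) g; [apply is_poly_const|apply HGL, Hg|intro; ring].
Qed.

Theorem putinar (N : nat) (G : fn -> Prop) (f : fn) :
  has_one G -> (forall g, G g -> is_poly N g) -> archimedean N G -> is_poly N f ->
  (forall c, (forall g, G g -> 0 <= g c) -> 0 < f c) ->
  qmod N G f.
Proof.
  intros G1 Gpoly HA Hf Hpos.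
  (* No point satisfies [G] together with [- f >= 0], so adjoining [- f] destroys properness and
     [-1 = s - t f] for some [s] in the module. *)
  assert (Hcert : exists t, sos N t /\ qmod N G (fun z => f z * t z - 1)).
  { assert (Hnp : ~ proper N (adjoin G (fun z => - f z))).
    { intro Hp; destruct (proper_has_point N (adjoin G (fun z => - f z))) as [c Hc].
      - left; exact G1.
      - intros g [Hg| ->]; [apply Gpoly, Hg|apply is_poly_opp, Hf].
      - eapply archimedean_mono; [|exact HA]; intros g Hg; left; exact Hg.
      - exact Hp.
      - assert (H1 : 0 < f c) by (apply Hpos; intros g Hg; apply Hc; left; exact Hg).
        assert (H2 : 0 <= - f c) by (apply (Hc (fun z => - f z)); right; reflexivity).
        lra. }
    apply NNPP in Hnp; apply qmod_adjoin in Hnp as (s & t & Hs & Ht & E); [|exact G1].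
    exists t; split; [exact Ht|]; eapply qmod_ext; [exact G1| |exact Hs].
    intro z; specialize (E z); simpl in *; lra. }
  destruct Hcert as (t & Ht & Hft).
  pose proof (sos_is_poly N t Ht) as Pt.
  destruct (HA _ Pt) as [C1 HC1].
  destruct (HA (fun z => t z ^ 2 * f z)) as [C2 HC2];
    [apply is_poly_mul; [apply is_poly_pow, Pt|exact Hf]|].
  destruct (HA (fun z => - f z) (is_poly_opp _ _ Hf)) as [r0 Hr0].
  (* Large enough for [2 k - t] and [2 k - 1 - t ^ 2 f] to lie in the module. *)
  set (k := 1 + Rabs C1 + Rabs C2).
  assert (Hk : 1 <= k /\ C1 <= 2 * k /\ C2 <= 2 * k - 1).
  { unfold k; pose proof (Rabs_pos C1); pose proof (Rabs_pos C2);
      pose proof (Rle_abs C1); pose proof (Rle_abs C2); lra. }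
  (* The decrease [/ k ^ 2] does not depend on [r], so about [r0 k ^ 2] steps lead from [f + r0] to
     [f]. In the identity the factor [(k - t) ^ 2] creates [- 2 k t f], which [2 k (f t - 1)]
     cancels at the gain of a constant. *)
  assert (step : forall r, 0 <= r -> qmod N G (fun z => f z + r) ->
                           qmod N G (fun z => f z + (r - / k ^ 2))).
  { intros r Hr Hfr.
    apply qmod_ext with (fun z => / k ^ 2 * (k ^ 2 * f z + k ^ 2 * r - 1));
      [exact G1|intro; field; lra|].
    apply qmod_scale; [exact G1|apply Rlt_le, Rinv_0_lt_compat, pow_lt; lra|].
    apply qmod_ext with (fun z => ((k - t z) ^ 2 * (f z + r) + 2 * k * (f z * t z - 1))
      + (r * (t z * (2 * k - t z)) + (2 * k - 1 - t z ^ 2 * f z)));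
      [exact G1|intro; ring|].
    apply qmod_add; apply qmod_add.
    - apply (qmod_sq_mul N G (fun z => k - t z) (fun z => f z + r)); [|exact Hfr].
      apply is_poly_sub; [apply is_poly_const|exact Pt].
    - apply (qmod_scale N G G1 _ (fun z => f z * t z - 1)); [lra|exact Hft].
    - apply (qmod_scale N G G1 _ (fun z => t z * (2 * k - t z))); [exact Hr|].
      apply (qmod_sos_mul N G G1 t (fun z => 2 * k - t z)); [exact Ht|].
      apply qmod_sum with (fun _ => 2 * k - C1) (fun z => C1 - t z);
        [apply qmod_const; [exact G1|lra]|exact HC1|intro; ring].
    - apply qmod_sum with (fun _ => 2 * k - 1 - C2) (fun z => C2 - t z ^ 2 * f z);
        [apply qmod_const; [exact G1|lra]|exact HC2|intro; ring]. }
  assert (neg : forall r, r <= 0 -> qmod N G (fun z => f z + r) -> qmod N G f).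
  { intros r Hr Hfr; apply qmod_sum with (fun z => f z + r) (fun _ => - r);
      [exact Hfr|apply qmod_const; [exact G1|lra]|intro; ring]. }
  assert (iter : forall i, qmod N G f \/ qmod N G (fun z => f z + (r0 - INR i * / k ^ 2))).
  { induction i as [|i [IH|IH]]; [right|left; exact IH|].
    - eapply qmod_ext; [exact G1| |exact Hr0]; intro; simpl; ring.
    - destruct (Rle_or_lt (r0 - INR i * / k ^ 2) 0) as [Hle|Hlt]; [left; eapply neg; eassumption|].
      right; eapply qmod_ext; [exact G1| |apply step; [|exact IH]; lra].
      intro; rewrite S_INR; ring. }
  destruct (INR_archimed 1 (r0 * k ^ 2)) as [i Hi]; [lra|].
  destruct (iter i) as [H|H]; [exact H|]; eapply neg; [|exact H].
  assert (Hk2 : 0 < k ^ 2) by (apply pow_lt; lra).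
  apply (Rmult_le_reg_r (k ^ 2)); [exact Hk2|].
  replace ((r0 - INR i * / k ^ 2) * k ^ 2) with (r0 * k ^ 2 - INR i) by (field; lra); lra.
Qed.

(** * The quadratic module of the abscissa program is Archimedean *)

Lemma is_poly_le (k N : nat) (f : fn) : (k <= N)%nat -> is_poly k f -> is_poly N f.
Proof.
  intros HkN (P & HP & E); exists P; split; [|exact E].
  eapply Forall_impl; [|exact HP]; simpl; intros; lia.
Qed.

Section Bounded.
Context (N : nat) (G : fn -> Prop) (G1 : has_one G).
Local Notation M := (qmod N G).

(** The polynomials bounded in this sense form a ring, so the Archimedean property has to be checked
    on coordinates only. *)
Definition qbounded (f : fn) : Prop :=
  exists C, 0 < C /\ M (fun z => C - f z) /\ M (fun z => C + f z).

Lemma qbounded_ext (f g : fn) : (forall z, f z = g z) -> qbounded f -> qbounded g.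
Proof.
  intros E (C & HC & H1 & H2); exists C; split; [exact HC|split].
  - eapply qmod_ext; [exact G1| |exact H1]; intro; simpl; rewrite E; reflexivity.
  - eapply qmod_ext; [exact G1| |exact H2]; intro; simpl; rewrite E; reflexivity.
Qed.

Lemma qbounded_add (f g : fn) : qbounded f -> qbounded g -> qbounded (fun z => f z + g z).
Proof.
  intros (C & HC & H1 & H2) (D & HD & H1' & H2'); exists (C + D); split; [lra|split].
  - eapply qmod_sum; [exact H1|exact H1'|intro; simpl; ring].
  - eapply qmod_sum; [exact H2|exact H2'|intro; simpl; ring].
Qed.

Lemma qbounded_const (c : R) : qbounded (fun _ => c).
Proof.
  exists (1 + Rabs c); split; [pose proof (Rabs_pos c); lra|].
  pose proof (Rle_abs c); pose proof (Rle_abs (- c)); rewrite Rabs_Ropp in *.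
  split; apply qmod_const; try exact G1; lra.
Qed.

Lemma qbounded_scale (c : R) (f : fn) : qbounded f -> qbounded (fun z => c * f z).
Proof.
  intros (C & HC & H1 & H2); pose proof (Rabs_pos c).
  (* [1 + Rabs c] instead of [Rabs c] keeps the bound positive when [c = 0]. *)
  exists ((1 + Rabs c) * C); split; [nra|].
  assert (Hrest : M (fun _ => C)) by (apply qmod_const; [exact G1|lra]).
  assert (Hpos : forall b g, 0 <= b -> M (fun z => C - g z) -> M (fun z => (1 + b) * C - b * g z)).
  { intros b g Hb Hg; apply qmod_sum with (fun z => b * (C - g z)) (fun _ => C);
      [apply (qmod_scale N G G1 b (fun z => C - g z)); assumption|exact Hrest|intro; ring]. }
  assert (H2' : M (fun z => C - - f z)) by (eapply qmod_ext; [exact G1| |exact H2]; intro; simpl; ring).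
  unfold Rabs in *; destruct (Rcase_abs c) as [Hc|Hc].
  - split; [eapply qmod_ext; [exact G1| |apply (Hpos (- c) (fun z => - f z)); [lra|exact H2']]
           |eapply qmod_ext; [exact G1| |apply (Hpos (- c) f); [lra|exact H1]]];
      intro; simpl; ring.
  - split; [apply Hpos; [lra|exact H1]|].
    eapply qmod_ext; [exact G1| |apply (Hpos c (fun z => - f z)); [lra|exact H2']].
    intro; simpl; ring.
Qed.

Lemma qbounded_sq (f : fn) : is_poly N f -> qbounded f -> qbounded (fun z => f z ^ 2).
Proof.
  intros Pf (C & HC & H1 & H2); exists (C ^ 2); split; [nra|split].
  - apply qmod_sq_sub; assumption.
  - eapply qmod_sum; [apply qmod_const; [exact G1|]|apply qmod_sq; [exact G1|exact Pf]|];
      [|intro; simpl; reflexivity]; nra.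
Qed.

(** Polarization reduces products to squares, for which [qmod_sq_sub] gives the bound. *)
Lemma qbounded_mul (f g : fn) : is_poly N f -> is_poly N g ->
  qbounded f -> qbounded g -> qbounded (fun z => f z * g z).
Proof.
  intros Pf Pg Bf Bg.
  apply qbounded_ext with (fun z => / 4 * (f z + g z) ^ 2 + (- / 4) * (f z + (-1) * g z) ^ 2);
    [intro; field|].
  assert (Pg' : is_poly N (fun z => (-1) * g z))
    by (apply is_poly_mul; [apply is_poly_const|exact Pg]).
  apply qbounded_add.
  - apply (qbounded_scale (/ 4) (fun z => (f z + g z) ^ 2)).
    apply (qbounded_sq (fun z => f z + g z));
      [apply is_poly_add; assumption|apply qbounded_add; assumption].
  - apply (qbounded_scale (- / 4) (fun z => (f z + (-1) * g z) ^ 2)).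
    apply (qbounded_sq (fun z => f z + (-1) * g z)); [apply is_poly_add; assumption|].
    apply (qbounded_add f (fun z => (-1) * g z)); [exact Bf|apply qbounded_scale, Bg].
Qed.

Lemma qbounded_poly (k : nat) : (k <= N)%nat ->
  (forall j, (j < k)%nat -> qbounded (fun z => z j)) ->
  forall f, is_poly k f -> qbounded f.
Proof.
  intros HkN Hj f Hf.
  cut (is_poly N f /\ qbounded f); [tauto|]; revert f Hf.
  apply is_poly_ind.
  - intros f g E [Pf Bf]; split; [eapply is_poly_ext|eapply qbounded_ext]; eassumption.
  - intro c; split; [apply is_poly_const|apply qbounded_const].
  - intros j Hjk; split; [apply is_poly_coord; lia|apply Hj, Hjk].
  - intros f g [Pf Bf] [Pg Bg]; split; [apply is_poly_add|apply qbounded_add]; assumption.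
  - intros f g [Pf Bf] [Pg Bg]; split; [apply is_poly_mul|apply qbounded_mul]; assumption.
Qed.

(** For [s = 1] and [s = -1], [(C - f ^ 2) + (1 + s f) ^ 2 = C + 1 + 2 s f]. The bound uses [Rabs C]
    because the sign of [C] is unknown. *)
Lemma qbounded_of_sq (C : R) (f : fn) : is_poly N f -> M (fun z => C - f z ^ 2) -> qbounded f.
Proof.
  intros Pf HC; exists ((1 + Rabs C) / 2 + 1); split; [pose proof (Rabs_pos C); lra|].
  pose proof (Rle_abs C) as HabsC.
  assert (H : forall s, s ^ 2 = 1 -> M (fun z => (1 + Rabs C) / 2 + 1 + s * f z)).
  { intros s Hs; apply qmod_sum with (fun z => / 2 * ((C - f z ^ 2) + (1 + s * f z) ^ 2))
      (fun _ => (Rabs C - C) / 2 + 1).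
    - apply qmod_scale; [exact G1|lra|]; apply qmod_add; [exact HC|].
      apply qmod_sq; [exact G1|]; apply is_poly_add; [apply is_poly_const|].
      apply is_poly_mul; [apply is_poly_const|exact Pf].
    - apply qmod_const; [exact G1|lra].
    - intro z; replace ((1 + s * f z) ^ 2) with (1 + 2 * (s * f z) + s ^ 2 * f z ^ 2) by ring.
      rewrite Hs; field. }
  split; [eapply qmod_ext; [exact G1| |apply (H (-1)); ring]
         |eapply qmod_ext; [exact G1| |apply (H 1); ring]]; intro; simpl; ring.
Qed.
End Bounded.

Lemma cpow_norm (x y : R) (k : nat) :
  fst (cpow x y k) ^ 2 + snd (cpow x y k) ^ 2 = (x ^ 2 + y ^ 2) ^ k.
Proof.
  induction k as [|k IH]; simpl; [ring|].
  destruct (cpow x y k) as [a b]; simpl in *; rewrite <- IH; ring.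
Qed.

Lemma is_poly_cpow (N i j k : nat) : (i < N)%nat -> (j < N)%nat ->
  is_poly N (fun z => fst (cpow (z i) (z j) k)) /\ is_poly N (fun z => snd (cpow (z i) (z j) k)).
Proof.
  intros Hi Hj; pose proof (is_poly_coord N i Hi) as Pi; pose proof (is_poly_coord N j Hj) as Pj.
  induction k as [|k [IH1 IH2]]; simpl; [split; apply is_poly_const|].
  pose proof (is_poly_mul _ _ _ IH1 Pi) as P1; pose proof (is_poly_mul _ _ _ IH2 Pj) as P2.
  pose proof (is_poly_mul _ _ _ IH1 Pj) as P3; pose proof (is_poly_mul _ _ _ IH2 Pi) as P4.
  split; [eapply is_poly_ext; [|exact (is_poly_sub _ _ _ P1 P2)]
         |eapply is_poly_ext; [|exact (is_poly_add _ _ _ P3 P4)]];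
    intro z; simpl; destruct (cpow (z i) (z j) k); reflexivity.
Qed.

(** Same layout as [qxy]: the coordinates below [n] are [q], followed by [x] and [y]. *)
Definition zRe (n m : nat) (pk : nat -> mpoly) : fn := fun z => pRe m pk z (z n) (z (S n)).
Definition zIm (n m : nat) (pk : nat -> mpoly) : fn := fun z => pIm m pk z (z n) (z (S n)).

(** Each equation enters as two opposite generators, which put it in the support and so allow
    multipliers of any sign. *)
Inductive abscissa_gens (n m : nat) (pk : nat -> mpoly) : fn -> Prop :=
| gens_one : abscissa_gens n m pk (fun _ => 1)
| gens_box j : (j < n)%nat -> abscissa_gens n m pk (fun z => 1 - z j ^ 2)
| gens_Re : abscissa_gens n m pk (zRe n m pk)
| gens_Re_opp : abscissa_gens n m pk (fun z => - zRe n m pk z)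
| gens_Im : abscissa_gens n m pk (zIm n m pk)
| gens_Im_opp : abscissa_gens n m pk (fun z => - zIm n m pk z).

Section AbscissaArchimedean.
Context (n m : nat) (pk : nat -> mpoly) (Hm : (1 <= m)%nat).
Context (Hpk : forall k, (k <= m)%nat -> mp_vars_lt (pk k) n).
Context (Hpm : forall q, mp_eval (pk m) q = 1).
Local Notation N := (n + 2)%nat.
Local Notation G := (abscissa_gens n m pk).
Local Notation M := (qmod N G).
Local Notation G1 := (gens_one n m pk : has_one G).

(** With [s = x + i y]: [X k] and [Y k] are the real and imaginary parts of [s ^ k], [r] is
    [|s| ^ 2], and [U j], [V j] are the parts of the sum of the [p_k s ^ k] over [k < j]. *)
Let X (k : nat) : fn := fun z => fst (cpow (z n) (z (S n)) k).
Let Y (k : nat) : fn := fun z => snd (cpow (z n) (z (S n)) k).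
Let r : fn := fun z => z n ^ 2 + z (S n) ^ 2.
Let U (j : nat) : fn := fun z => sumR j (fun k => mp_eval (pk k) z * X k z).
Let V (j : nat) : fn := fun z => sumR j (fun k => mp_eval (pk k) z * Y k z).

Lemma is_poly_X k : is_poly N (X k).
Proof. apply (is_poly_cpow N n (S n) k); lia. Qed.
Lemma is_poly_Y k : is_poly N (Y k).
Proof. apply (is_poly_cpow N n (S n) k); lia. Qed.
Lemma is_poly_pk k : (k <= m)%nat -> is_poly N (mp_eval (pk k)).
Proof. intro Hk; apply is_poly_le with n; [lia|apply is_poly_mp_eval, Hpk, Hk]. Qed.
Lemma is_poly_U j : (j <= S m)%nat -> is_poly N (U j).
Proof.
  intro Hj; apply (is_poly_sumR N j (fun k z => mp_eval (pk k) z * X k z)).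
  intros i Hi; apply is_poly_mul; [apply is_poly_pk; lia|apply is_poly_X].
Qed.
Lemma is_poly_V j : (j <= S m)%nat -> is_poly N (V j).
Proof.
  intro Hj; apply (is_poly_sumR N j (fun k z => mp_eval (pk k) z * Y k z)).
  intros i Hi; apply is_poly_mul; [apply is_poly_pk; lia|apply is_poly_Y].
Qed.

Lemma abscissa_gens_poly (g : fn) : G g -> is_poly N g.
Proof.
  assert (PR : is_poly N (zRe n m pk)) by (apply (is_poly_U (S m)); lia).
  assert (PI : is_poly N (zIm n m pk)) by (apply (is_poly_V (S m)); lia).
  intros [|j Hj| | | |]; try assumption; try (apply is_poly_opp; assumption).
  - apply is_poly_const.
  - apply is_poly_sub; [apply is_poly_const|apply is_poly_pow, is_poly_coord; lia].
Qed.

Lemma XY_r k z : X k z ^ 2 + Y k z ^ 2 = r z ^ k.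
Proof. apply cpow_norm. Qed.

(** For odd [k] too, [r ^ k = X k ^ 2 + Y k ^ 2] is a sum of two squares. *)
Lemma qmod_rpow_mul (k : nat) (f : fn) : M f -> M (fun z => r z ^ k * f z).
Proof.
  intro Hf; apply qmod_sum with (fun z => X k z ^ 2 * f z) (fun z => Y k z ^ 2 * f z).
  - apply qmod_sq_mul; [apply is_poly_X|exact Hf].
  - apply qmod_sq_mul; [apply is_poly_Y|exact Hf].
  - intro z; rewrite <- XY_r; ring.
Qed.

Lemma qmod_rpow (k : nat) : M (fun z => r z ^ k).
Proof.
  eapply qmod_ext; [exact G1| |apply (qmod_rpow_mul k (fun _ => 1))].
  - intro; simpl; ring.
  - apply qmod_const; [exact G1|lra].
Qed.

Lemma is_poly_r : is_poly N r.
Proof. apply is_poly_add; apply is_poly_pow, is_poly_coord; lia. Qed.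

(** Lower powers of [r] are negligible against higher ones, with a certificate; this lets the
    leading term of [p] absorb all others. *)
Lemma rpow_le_succ (k : nat) : forall eps, 0 < eps ->
  exists C, M (fun z => eps * r z ^ (S k) + C - r z ^ k).
Proof.
  induction k as [|k IH]; intros eps Heps.
  - exists 1; eapply qmod_ext; [exact G1| |].
    2: apply (qmod_scale N G G1 eps); [lra|apply (qmod_rpow 1)].
    intro; simpl; ring.
  - destruct (IH eps Heps) as [C HC]; exists (C / eps).
    (* completing the square in [r - 1 / eps] *)
    apply qmod_sum with (fun z => 2 * (eps / 2 * (r z ^ k * (r z - / eps) ^ 2)))
      (fun z => / eps * (eps * r z ^ (S k) + C - r z ^ k)).
    + apply qmod_scale; [exact G1|lra|]; apply qmod_scale; [exact G1|lra|].
      apply (qmod_rpow_mul k (fun z => (r z - / eps) ^ 2)), qmod_sq; [exact G1|].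
      apply is_poly_sub; [exact is_poly_r|apply is_poly_const].
    + apply qmod_scale; [exact G1| |exact HC]; apply Rlt_le, Rinv_0_lt_compat; exact Heps.
    + intro z; simpl; field; lra.
Qed.

Lemma rpow_le (k j : nat) : forall eps, 0 < eps ->
  exists C, M (fun z => eps * r z ^ (S k + j) + C - r z ^ k).
Proof.
  induction j as [|j IH]; intros eps Heps.
  - rewrite Nat.add_0_r; apply rpow_le_succ; exact Heps.
  - destruct (IH 1) as [C HC]; [lra|].
    destruct (rpow_le_succ (S k + j) eps Heps) as [D HD]; exists (C + D).
    eapply qmod_sum; [exact HC|exact HD|].
    intro z; simpl; rewrite !Nat.add_succ_r; simpl; ring.
Qed.

Lemma box_qbounded (j : nat) : (j < n)%nat -> qbounded N G (fun z => z j).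
Proof.
  intro Hj; apply (qbounded_of_sq N G G1 1); [apply is_poly_coord; lia|].
  apply qmod_gen with (fun _ => 1) (fun z => 1 - z j ^ 2);
    [apply is_poly_const|apply gens_box, Hj|intro; ring].
Qed.

Lemma lower_terms_le (j : nat) : (j <= m)%nat -> forall eps, 0 < eps ->
  exists C, M (fun z => eps * r z ^ m + C - (U j z ^ 2 + V j z ^ 2)).
Proof.
  induction j as [|j IH]; intros Hj eps Heps.
  - exists 0; eapply qmod_ext; [exact G1| |apply (qmod_scale N G G1 eps); [lra|apply (qmod_rpow m)]].
    intro z; unfold U, V; simpl; ring.
  - assert (Pp : is_poly N (mp_eval (pk j))) by (apply is_poly_pk; lia).
    assert (Bp : qbounded N G (fun z => mp_eval (pk j) z ^ 2)).
    { apply (qbounded_poly N G G1 n); [lia|exact box_qbounded|].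
      apply is_poly_pow, is_poly_mp_eval, Hpk; lia. }
    destruct Bp as (K & HK & HKp & _).
    (* By [(u + v) ^ 2 <= 2 u ^ 2 + 2 v ^ 2], whose slack is [(u - v) ^ 2], both estimates are
       doubled; the second is also multiplied by the bound [K] on [p_j ^ 2]. Each thus contributes
       [eps / 2]. *)
    destruct (IH ltac:(lia) (eps / 4)) as [C1 H1]; [lra|].
    destruct (rpow_le j (m - S j) (eps / (4 * K))) as [C2 H2]; [apply Rdiv_lt_0_compat; lra|].
    replace (S j + (m - S j))%nat with m in H2 by lia.
    exists (2 * C1 + 2 * K * C2).
    apply qmod_sum with
      (fun z => 2 * (eps / 4 * r z ^ m + C1 - (U j z ^ 2 + V j z ^ 2))
                + 2 * (r z ^ j * (K - mp_eval (pk j) z ^ 2)))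
      (fun z => 2 * K * (eps / (4 * K) * r z ^ m + C2 - r z ^ j)
                + ((U j z - mp_eval (pk j) z * X j z) ^ 2
                   + (V j z - mp_eval (pk j) z * Y j z) ^ 2)).
    + apply qmod_add; (apply qmod_scale; [exact G1|lra|]); [exact H1|].
      apply (qmod_rpow_mul j (fun z => K - mp_eval (pk j) z ^ 2)), HKp.
    + apply qmod_add; [apply qmod_scale; [exact G1|lra|exact H2]|].
      apply qmod_add; (apply qmod_sq; [exact G1|]).
      * apply is_poly_sub; [apply is_poly_U; lia|apply is_poly_mul; [exact Pp|apply is_poly_X]].
      * apply is_poly_sub; [apply is_poly_V; lia|apply is_poly_mul; [exact Pp|apply is_poly_Y]].
    + intro z; unfold U, V; simpl sumR; fold (U j z) (V j z).
      rewrite <- (XY_r j z); field; lra.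
Qed.

Lemma qmod_ideal (g t : fn) : G g -> G (fun z => - g z) -> is_poly N t -> M (fun z => g z * t z).
Proof.
  intros Hg Hg' Ht; apply (qmod_support_mul N G); [| |exact Ht].
  - apply qmod_gen with (fun _ => 1) g; [apply is_poly_const|exact Hg|intro; ring].
  - apply qmod_gen with (fun _ => 1) (fun z => - g z); [apply is_poly_const|exact Hg'|intro; ring].
Qed.

(** At a root, [s ^ m] is minus the lower terms, so [r ^ m <= r ^ m / 2 + C]. The ideal multipliers
    come from [(zRe - X m) ^ 2 = X m ^ 2 + zRe (zRe - 2 X m)] and its analogue for [zIm]. *)
Lemma r_bounded : exists C, M (fun z => C - r z).
Proof.
  destruct (lower_terms_le m (le_n m) (1 / 2)) as [C HC]; [lra|].
  assert (Hr : exists D, M (fun z => r z ^ m + D - r z)).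
  (* [rpow_le] compares strictly increasing exponents, so [r ^ 1] against [r ^ m] needs [m >= 2]. *)
  { destruct (Nat.eq_dec m 1) as [Em|Em].
    - exists 0; eapply qmod_ext; [exact G1| |apply (qmod_const N G G1 0); lra].
      intro; rewrite Em; simpl; ring.
    - destruct (rpow_le 1 (m - 2) 1) as [D HD]; [lra|exists D].
      replace (2 + (m - 2))%nat with m in HD by lia.
      eapply qmod_ext; [exact G1| |exact HD]; intro; simpl; ring. }
  destruct Hr as [D HD]; exists (2 * C + D).
  (* modulo the ideal, [r ^ m = U m ^ 2 + V m ^ 2] *)
  apply qmod_sum with (fun z => 2 * ((1 / 2 * r z ^ m + C - (U m z ^ 2 + V m z ^ 2))
      + (zRe n m pk z * (zRe n m pk z - 2 * X m z) + zIm n m pk z * (zIm n m pk z - 2 * Y m z))))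
    (fun z => r z ^ m + D - r z); [|exact HD|].
  - apply qmod_scale; [exact G1|lra|]; apply qmod_add; [exact HC|]; apply qmod_add.
    + apply (qmod_ideal (zRe n m pk) (fun z => zRe n m pk z - 2 * X m z)); try constructor.
      apply is_poly_sub; [apply abscissa_gens_poly; constructor|].
      apply is_poly_mul; [apply is_poly_const|apply is_poly_X].
    + apply (qmod_ideal (zIm n m pk) (fun z => zIm n m pk z - 2 * Y m z)); try constructor.
      apply is_poly_sub; [apply abscissa_gens_poly; constructor|].
      apply is_poly_mul; [apply is_poly_const|apply is_poly_Y].
  - intro z.
    assert (ER : zRe n m pk z = U m z + X m z).
    { unfold zRe, pRe; simpl; rewrite Hpm; unfold U, X; ring. }
    assert (EI : zIm n m pk z = V m z + Y m z).
    { unfold zIm, pIm; simpl; rewrite Hpm; unfold V, Y; ring. }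
    rewrite ER, EI, <- (XY_r m z); field.
Qed.

Lemma abscissa_archimedean : archimedean N G.
Proof.
  intros h Hh; cut (qbounded N G h); [intros (C & _ & H & _); exists C; exact H|].
  apply (qbounded_poly N G G1 N); [lia| |exact Hh].
  intros j Hj; destruct (Nat.lt_ge_cases j n) as [Hjn|Hjn]; [apply box_qbounded, Hjn|].
  destruct r_bounded as [C HC].
  apply (qbounded_of_sq N G G1 C); [apply is_poly_coord, Hj|].
  assert (Hcase : j = n \/ j = S n) by lia; destruct Hcase as [-> | ->].
  - apply qmod_sum with (fun z => C - r z) (fun z => z (S n) ^ 2);
      [exact HC|apply qmod_sq; [exact G1|apply is_poly_coord; lia]|intro; unfold r; ring].
  - apply qmod_sum with (fun z => C - r z) (fun z => z n ^ 2);
      [exact HC|apply qmod_sq; [exact G1|apply is_poly_coord; lia]|intro; unfold r; ring].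
Qed.
End AbscissaArchimedean.

(** * Riemann sums over the cube *)

(** Only the coordinates below [n] are compared, so such an [f] depends on these alone when
    restricted to the cube. *)
Definition cube_ucont (n : nat) (f : fn) : Prop :=
  forall eps, 0 < eps -> exists delta, 0 < delta /\
    forall q q', in_cube n q -> in_cube n q' ->
      (forall j, (j < n)%nat -> Rabs (q j - q' j) <= delta) -> Rabs (f q - f q') <= eps.

Definition scons (x : R) (q : nat -> R) : nat -> R :=
  fun j => match j with O => x | S j' => q j' end.

Lemma in_cube_scons (n : nat) (x : R) (q : nat -> R) :
  -1 <= x <= 1 -> in_cube n q -> in_cube (S n) (scons x q).
Proof. intros Hx Hq [|j] Hj; simpl; [exact Hx|apply Hq; lia]. Qed.

Lemma sumR_ext (n : nat) (f g : nat -> R) :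
  (forall i, (i < n)%nat -> f i = g i) -> sumR n f = sumR n g.
Proof.
  induction n as [|n IH]; intro H; simpl; [reflexivity|].
  rewrite IH, (H n); [reflexivity|lia|intros; apply H; lia].
Qed.

Lemma sumR_le (n : nat) (f g : nat -> R) :
  (forall i, (i < n)%nat -> f i <= g i) -> sumR n f <= sumR n g.
Proof.
  induction n as [|n IH]; intro H; simpl; [lra|].
  apply Rplus_le_compat; [apply IH; intros; apply H; lia|apply H; lia].
Qed.

Lemma sumR_minus (n : nat) (f g : nat -> R) :
  sumR n (fun i => f i - g i) = sumR n f - sumR n g.
Proof. induction n as [|n IH]; simpl; [ring|rewrite IH; ring]. Qed.

Lemma sumR_const (n : nat) (c : R) : sumR n (fun _ => c) = INR n * c.
Proof. induction n as [|n IH]; [simpl; ring|rewrite S_INR; simpl; rewrite IH; ring]. Qed.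

Lemma sumR_Rabs (n : nat) (f : nat -> R) (c : R) :
  (forall i, (i < n)%nat -> Rabs (f i) <= c) -> Rabs (sumR n f) <= INR n * c.
Proof.
  induction n as [|n IH]; intro H; [simpl; rewrite Rabs_R0; lra|rewrite S_INR; simpl].
  eapply Rle_trans; [apply Rabs_triang|].
  assert (H1 := H n ltac:(lia)); assert (H2 := IH ltac:(intros; apply H; lia)); lra.
Qed.

Lemma sumR_add (n k : nat) (f : nat -> R) :
  sumR (n + k) f = sumR n f + sumR k (fun j => f (n + j)%nat).
Proof.
  induction k as [|k IH]; simpl; [rewrite Nat.add_0_r; ring|].
  rewrite Nat.add_succ_r; simpl; rewrite IH; ring.
Qed.

Lemma sumR_mul_index (n k : nat) (f : nat -> R) :
  sumR (n * k) f = sumR n (fun i => sumR k (fun j => f (i * k + j)%nat)).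
Proof.
  induction n as [|n IH]; simpl; [reflexivity|].
  rewrite Nat.add_comm, sumR_add, IH; reflexivity.
Qed.

Definition midpoint (N i : nat) : R := -1 + (2 * INR i + 1) / INR N.

Lemma midpoint_range (N i : nat) : (i < N)%nat -> -1 <= midpoint N i <= 1.
Proof.
  intro Hi; unfold midpoint; assert (HN : 0 < INR N) by (apply lt_0_INR; lia).
  assert (Hi' : INR i + 1 <= INR N) by (rewrite <- S_INR; apply le_INR; lia).
  assert (H0 : 0 <= INR i) by apply pos_INR.
  assert (H1 : 0 <= (2 * INR i + 1) / INR N) by (apply Rle_mult_inv_pos; lra).
  assert (H2 : (2 * INR i + 1) / INR N <= 2).
  { apply (Rmult_le_reg_r (INR N)); [exact HN|].
    replace ((2 * INR i + 1) / INR N * INR N) with (2 * INR i + 1) by (field; lra); lra. }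
  lra.
Qed.

Lemma rsum_cube_S (N n : nat) (f : fn) :
  rsum_cube N (S n) f
  = sumR N (fun i => 2 / INR N * rsum_cube N n (fun q => f (scons (midpoint N i) q))).
Proof. reflexivity. Qed.

Lemma rsum_cube_ext (N n : nat) : forall f g : fn,
  (forall q, in_cube n q -> f q = g q) -> rsum_cube N n f = rsum_cube N n g.
Proof.
  induction n as [|n IH]; intros f g H; [apply H; intros j Hj; lia|].
  rewrite !rsum_cube_S; apply sumR_ext; intros i Hi; f_equal; apply IH.
  intros q Hq; apply H, in_cube_scons; [apply midpoint_range, Hi|exact Hq].
Qed.

Lemma rsum_cube_sub (N n : nat) : forall f g : fn,
  rsum_cube N n (fun q => f q - g q) = rsum_cube N n f - rsum_cube N n g.
Proof.
  induction n as [|n IH]; intros f g; [reflexivity|].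
  rewrite !rsum_cube_S, <- sumR_minus; apply sumR_ext; intros i Hi.
  rewrite (IH (fun q => f (scons (midpoint N i) q)) (fun q => g (scons (midpoint N i) q))); ring.
Qed.

Lemma rsum_cube_le_add (N n : nat) (c : R) : (0 < N)%nat -> forall f g : fn,
  (forall q, in_cube n q -> f q <= g q + c) ->
  rsum_cube N n f <= rsum_cube N n g + 2 ^ n * c.
Proof.
  intro HN; assert (HN' : 0 < INR N) by (apply lt_0_INR; exact HN).
  induction n as [|n IH]; intros f g H.
  - simpl; rewrite Rmult_1_l; apply H; intros j Hj; lia.
  - rewrite !rsum_cube_S.
    replace (2 ^ S n * c) with (sumR N (fun _ => 2 / INR N * (2 ^ n * c)))
      by (rewrite sumR_const; simpl; field; lra).
    match goal with |- ?a <= ?b + ?e => cut (a - b <= e); [lra|] end.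
    rewrite <- sumR_minus; apply sumR_le; intros i Hi.
    assert (Hi' := IH (fun q => f (scons (midpoint N i) q)) (fun q => g (scons (midpoint N i) q))
      ltac:(intros q Hq; apply H, in_cube_scons; [apply midpoint_range, Hi|exact Hq])).
    assert (H2 : 0 < 2 / INR N) by (apply Rdiv_lt_0_compat; lra).
    nra.
Qed.

(** Both points lie in the [i]-th coarse cell, which has width [2 / N]. *)
Lemma midpoint_refine (N K i j : nat) : (0 < N)%nat -> (j < K)%nat ->
  Rabs (midpoint N i - midpoint (N * K) (i * K + j)) <= 2 / INR N.
Proof.
  intros HN HK; unfold midpoint.
  assert (HN' : 0 < INR N) by (apply lt_0_INR; exact HN).
  assert (HK' : 0 < INR K) by (apply lt_0_INR; lia).
  assert (Hj : INR j + 1 <= INR K) by (rewrite <- S_INR; apply le_INR; lia).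
  assert (Hj0 := pos_INR j).
  rewrite mult_INR, plus_INR, mult_INR.
  replace (-1 + (2 * INR i + 1) / INR N
           - (-1 + (2 * (INR i * INR K + INR j) + 1) / (INR N * INR K)))
    with (/ (INR N * INR K) * (INR K - 2 * INR j - 1)) by (field; lra).
  replace (2 / INR N) with (/ (INR N * INR K) * (2 * INR K)) by (field; lra).
  assert (HNK : 0 < / (INR N * INR K)) by (apply Rinv_0_lt_compat; nra).
  rewrite Rabs_mult, (Rabs_pos_eq (/ (INR N * INR K))) by lra.
  apply Rmult_le_compat_l; [lra|]; apply Rabs_le; lra.
Qed.

(* Two functions are compared because fixing the first coordinate of a single
   [f] at the coarse and at the fine midpoint produces two. *)
Lemma rsum_cube_refine (N K n : nat) (eps : R) : (0 < N)%nat -> (0 < K)%nat ->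
  forall f g : fn,
  (forall q q', in_cube n q -> in_cube n q' ->
     (forall j, (j < n)%nat -> Rabs (q j - q' j) <= 2 / INR N) -> Rabs (f q - g q') <= eps) ->
  Rabs (rsum_cube N n f - rsum_cube (N * K) n g) <= 2 ^ n * eps.
Proof.
  intros HN HK; induction n as [|n IH]; intros f g H.
  - simpl; rewrite Rmult_1_l; apply H; intros j Hj; lia.
  - assert (HN' : 0 < INR N) by (apply lt_0_INR; exact HN).
    assert (HK' : 0 < INR K) by (apply lt_0_INR; exact HK).
    set (F := fun i => rsum_cube N n (fun q => f (scons (midpoint N i) q))).
    set (F' := fun i => rsum_cube (N * K) n (fun q => g (scons (midpoint (N * K) i) q))).
    replace (rsum_cube N (S n) f - rsum_cube (N * K) (S n) g)
      with (sumR N (fun i => sumR K (fun j => 2 / (INR N * INR K) * (F i - F' (i * K + j)%nat)))).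
    + replace (2 ^ S n * eps) with (INR N * (INR K * (2 / (INR N * INR K) * (2 ^ n * eps))))
        by (simpl; field; lra).
      apply sumR_Rabs; intros i Hi; apply sumR_Rabs; intros j Hj.
      assert (Hpos : 0 < 2 / (INR N * INR K)) by (apply Rdiv_lt_0_compat; nra).
      rewrite Rabs_mult, (Rabs_pos_eq (2 / (INR N * INR K))) by lra.
      apply Rmult_le_compat_l; [lra|]; apply IH; intros q q' Hq Hq' Hqq.
      apply H; [apply in_cube_scons; [apply midpoint_range, Hi|exact Hq]
               |apply in_cube_scons; [apply midpoint_range; nia|exact Hq']|].
      intros [|l] Hl; simpl; [apply midpoint_refine; assumption|apply Hqq; lia].
    + rewrite !rsum_cube_S, sumR_mul_index, <- sumR_minus; apply sumR_ext; intros i Hi.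
      fold (F i).
      replace (2 / INR N * F i) with (sumR K (fun _ => 2 / (INR N * INR K) * F i))
        by (rewrite sumR_const; field; lra).
      rewrite <- sumR_minus; apply sumR_ext; intros j Hj.
      fold (F' (i * K + j)%nat); rewrite mult_INR; ring.
Qed.

(** The grids [N] and [N'] are both compared with their common refinement [N * N']. *)
Lemma rsum_cube_Cauchy (n : nat) (f : fn) :
  cube_ucont n f -> Cauchy_crit (fun N => rsum_cube N n f).
Proof.
  intros Hf eps Heps.
  assert (H2n : 0 < 2 ^ n) by (apply pow_lt; lra).
  destruct (Hf (eps / (4 * 2 ^ n))) as (delta & Hd & Hdf); [apply Rdiv_lt_0_compat; lra|].
  destruct (INR_archimed delta 2 Hd) as [N0 HN0].
  assert (Hpos : (0 < N0)%nat).
  { destruct N0; [simpl in HN0; lra|lia]. }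
  assert (Href : forall N K, (N0 <= N)%nat -> (0 < K)%nat ->
    Rabs (rsum_cube N n f - rsum_cube (N * K) n f) <= eps / 4).
  { intros N K HN HK.
    replace (eps / 4) with (2 ^ n * (eps / (4 * 2 ^ n))) by (field; lra).
    apply rsum_cube_refine; [lia|exact HK|].
    intros q q' Hq Hq' Hqq; apply Hdf; [exact Hq|exact Hq'|].
    intros j Hj; eapply Rle_trans; [apply Hqq, Hj|].
    assert (HNR : INR N0 <= INR N) by (apply le_INR; exact HN).
    assert (HN' : 0 < INR N) by (apply lt_0_INR; lia).
    apply (Rmult_le_reg_r (INR N)); [exact HN'|].
    replace (2 / INR N * INR N) with 2 by (field; lra).
    nra. }
  exists N0; intros N N' HN HN'; unfold Rdist.
  assert (H1 := Href N N' HN ltac:(lia)); assert (H2 := Href N' N HN' ltac:(lia)).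
  rewrite Nat.mul_comm in H2.
  replace (rsum_cube N n f - rsum_cube N' n f)
    with ((rsum_cube N n f - rsum_cube (N * N') n f)
          - (rsum_cube N' n f - rsum_cube (N * N') n f)) by ring.
  unfold Rminus at 1; eapply Rle_lt_trans; [apply Rabs_triang|]; rewrite Rabs_Ropp; lra.
Qed.

(** [epsilon] returns the limit only because one exists; the Cauchy criterion supplies it. *)
Lemma cube_int_cv (n : nat) (f : fn) :
  cube_ucont n f -> Un_cv (fun N => rsum_cube N n f) (cube_int n f).
Proof.
  intro Hf; unfold cube_int; apply epsilon_spec.
  destruct (R_complete _ (rsum_cube_Cauchy n f Hf)) as [l Hl]; exists l; exact Hl.
Qed.

Lemma Un_cv_le_add (u v : nat -> R) (l k c : R) :
  Un_cv u l -> Un_cv v k -> (forall N, (0 < N)%nat -> u N <= v N + c) -> l <= k + c.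
Proof.
  intros Hu Hv H; apply Rnot_lt_le; intro Hlt; set (e := (l - (k + c)) / 2).
  destruct (Hu e) as [N1 H1]; [unfold e; lra|]; destruct (Hv e) as [N2 H2]; [unfold e; lra|].
  specialize (H (S (N1 + N2)) ltac:(lia)); specialize (H1 (S (N1 + N2)) ltac:(lia)).
  specialize (H2 (S (N1 + N2)) ltac:(lia)); unfold Rdist in *.
  apply Rabs_def2 in H1; apply Rabs_def2 in H2; unfold e in *; lra.
Qed.

Lemma cube_int_le_add (n : nat) (f g : fn) (c : R) :
  cube_ucont n f -> cube_ucont n g -> (forall q, in_cube n q -> f q <= g q + c) ->
  cube_int n f <= cube_int n g + 2 ^ n * c.
Proof.
  intros Hf Hg H; eapply Un_cv_le_add; [apply cube_int_cv, Hf|apply cube_int_cv, Hg|].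
  intros N HN; apply rsum_cube_le_add; assumption.
Qed.

(** All grid points lie in the cube, so the Riemann sums of [|f - g|] are the differences of those
    of [f] and [g] and inherit their convergence. *)
Lemma cube_int_Rabs_sub (n : nat) (f g : fn) :
  cube_ucont n f -> cube_ucont n g -> (forall q, in_cube n q -> g q <= f q) ->
  cube_int n (fun q => Rabs (f q - g q)) = cube_int n f - cube_int n g.
Proof.
  intros Hf Hg H.
  assert (Hcv : Un_cv (fun N => rsum_cube N n (fun q => Rabs (f q - g q)))
                      (cube_int n f - cube_int n g)).
  { apply Un_cv_ext with (fun N => rsum_cube N n f - rsum_cube N n g).
    - intro N; rewrite <- rsum_cube_sub; apply rsum_cube_ext.
      intros q Hq; specialize (H q Hq); rewrite Rabs_pos_eq; lra.
    - apply CV_minus; apply cube_int_cv; assumption. }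
  eapply UL_sequence; [|exact Hcv].
  unfold cube_int at 1; apply epsilon_spec; eexists; exact Hcv.
Qed.

(** Continuity of a product uses bounds on its factors, so both properties are proved in one
    induction. *)
Lemma is_poly_cube_ucont (n : nat) (f : fn) : is_poly n f ->
  cube_ucont n f /\ exists B, 0 < B /\ forall q, in_cube n q -> Rabs (f q) <= B.
Proof.
  revert f; apply is_poly_ind.
  - intros f g E (Uf & B & HB & Bf); split.
    + intros eps Heps; destruct (Uf eps Heps) as (d & Hd & H); exists d; split; [exact Hd|].
      intros; rewrite <- !E; apply H; assumption.
    + exists B; split; [exact HB|]; intros; rewrite <- E; apply Bf; assumption.
  - intro c; split.
    + intros eps Heps; exists 1; split; [lra|].
      intros; replace (c - c) with 0 by ring; rewrite Rabs_R0; lra.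
    + exists (1 + Rabs c); pose proof (Rabs_pos c); split; [lra|intros; lra].
  - intros j Hj; split.
    + intros eps Heps; exists eps; split; [exact Heps|]; intros q q' _ _ H; apply H, Hj.
    + exists 1; split; [lra|]; intros q Hq; apply Rabs_le, Hq, Hj.
  - intros f g (Uf & B & HB & Bf) (Ug & D & HD & Dg); split.
    + intros eps Heps; destruct (Uf (eps / 2)) as (d & Hd & H); [lra|].
      destruct (Ug (eps / 2)) as (d' & Hd' & H'); [lra|].
      exists (Rmin d d'); split; [apply Rmin_glb_lt; assumption|]; intros q q' Hq Hq' Hqq.
      replace (f q + g q - (f q' + g q')) with ((f q - f q') + (g q - g q')) by ring.
      eapply Rle_trans; [apply Rabs_triang|].
      assert (Hf := H q q' Hq Hq' ltac:(intros j Hj; eapply Rle_trans; [apply Hqq, Hj|apply Rmin_l])).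
      assert (Hg := H' q q' Hq Hq' ltac:(intros j Hj; eapply Rle_trans; [apply Hqq, Hj|apply Rmin_r])).
      lra.
    + exists (B + D); split; [lra|]; intros q Hq; eapply Rle_trans; [apply Rabs_triang|].
      specialize (Bf q Hq); specialize (Dg q Hq); lra.
  - intros f g (Uf & B & HB & Bf) (Ug & D & HD & Dg); split.
    + intros eps Heps.
      destruct (Uf (eps / (2 * D))) as (d & Hd & H); [apply Rdiv_lt_0_compat; lra|].
      destruct (Ug (eps / (2 * B))) as (d' & Hd' & H'); [apply Rdiv_lt_0_compat; lra|].
      exists (Rmin d d'); split; [apply Rmin_glb_lt; assumption|]; intros q q' Hq Hq' Hqq.
      replace (f q * g q - f q' * g q') with ((f q - f q') * g q + f q' * (g q - g q')) by ring.
      eapply Rle_trans; [apply Rabs_triang|]; rewrite !Rabs_mult.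
      assert (Hf := H q q' Hq Hq' ltac:(intros j Hj; eapply Rle_trans; [apply Hqq, Hj|apply Rmin_l])).
      assert (Hg := H' q q' Hq Hq' ltac:(intros j Hj; eapply Rle_trans; [apply Hqq, Hj|apply Rmin_r])).
      replace eps with (eps / (2 * D) * D + B * (eps / (2 * B))) by (field; lra).
      apply Rplus_le_compat; apply Rmult_le_compat; try apply Rabs_pos; auto.
    + exists (B * D); split; [nra|]; intros q Hq; rewrite Rabs_mult.
      apply Rmult_le_compat; try apply Rabs_pos; auto.
Qed.

(** * Polynomial approximation on the cube *)

(* The Bernstein operator, i.e. the mean of [h] under the binomial law of
   parameters [N] and [t], computed by conditioning on one trial. *)
Fixpoint bernstein (N : nat) (h : nat -> R) (t : R) : R :=
  match N with
  | O => h 0%nat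
  | S N' => (1 - t) * bernstein N' h t + t * bernstein N' (fun k => h (S k)) t
  end.

(** A quadratic majorant of the error is averaged exactly: the binomial mean of [(k - c) ^ 2] is
    [(N t - c) ^ 2 + N t (1 - t)]. The centre [c] varies because a successful trial shifts it to
    [c - 1]. *)
Lemma bernstein_error (N : nat) (t v a b : R) : 0 <= t <= 1 -> forall (h : nat -> R) (c : R),
  (forall k, (k <= N)%nat -> Rabs (h k - v) <= a + b * (INR k - c) ^ 2) ->
  Rabs (bernstein N h t - v) <= a + b * ((INR N * t - c) ^ 2 + INR N * t * (1 - t)).
Proof.
  intro Ht; induction N as [|N IH]; intros h c H.
  - eapply Rle_trans; [apply (H 0%nat (le_n 0))|right; simpl; ring].
  - simpl bernstein; rewrite S_INR.
    assert (H1 := IH h c ltac:(intros k Hk; apply H; lia)).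
    assert (H2 := IH (fun k => h (S k)) (c - 1)
      ltac:(intros k Hk; specialize (H (S k) ltac:(lia)); rewrite S_INR in H;
            replace (INR k - (c - 1)) with (INR k + 1 - c) by ring; exact H)).
    set (B1 := bernstein N h t) in *; set (B2 := bernstein N (fun k => h (S k)) t) in *.
    replace ((1 - t) * B1 + t * B2 - v) with ((1 - t) * (B1 - v) + t * (B2 - v)) by ring.
    eapply Rle_trans; [apply Rabs_triang|].
    rewrite !Rabs_mult, (Rabs_pos_eq (1 - t)), (Rabs_pos_eq t) by lra.
    apply Rle_trans with
      ((1 - t) * (a + b * ((INR N * t - c) ^ 2 + INR N * t * (1 - t)))
       + t * (a + b * ((INR N * t - (c - 1)) ^ 2 + INR N * t * (1 - t)))).
    + apply Rplus_le_compat; apply Rmult_le_compat_l; lra.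
    + right; ring.
Qed.

Lemma is_poly_bernstein (n N : nat) (s : fn) : is_poly n s -> forall P : nat -> fn,
  (forall k, is_poly n (P k)) -> is_poly n (fun q => bernstein N (fun k => P k q) (s q)).
Proof.
  intro Hs; induction N as [|N IH]; intros P HP; [apply HP|]; simpl.
  apply is_poly_add; apply is_poly_mul.
  - apply is_poly_sub; [apply is_poly_const|exact Hs].
  - apply IH, HP.
  - exact Hs.
  - apply (IH (fun k => P (S k))); intro; apply HP.
Qed.

(** Induction on the dimension: the Bernstein operator acts in the first variable, and its
    coefficients are polynomial approximations of the slices of [f] at the nodes [x k]. *)
Lemma cube_weierstrass (n : nat) : forall (f : fn) (B : R),
  (forall q, in_cube n q -> Rabs (f q) <= B) -> cube_ucont n f ->
  forall eps, 0 < eps -> exists g, is_poly n g /\ forall q, in_cube n q -> Rabs (g q - f q) <= eps.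
Proof.
  induction n as [|n IH]; intros f B HB Uf eps Heps.
  - exists (fun _ => f (fun _ => 0)); split; [apply is_poly_const|].
    destruct (Uf eps Heps) as (d & Hd & H).
    intros q Hq; apply H; [intros j Hj; lia|exact Hq|intros j Hj; lia].
  - destruct (Uf (eps / 4)) as (d & Hd & Hdf); [lra|].
    assert (HB0 : 0 <= B).
    { eapply Rle_trans; [apply Rabs_pos|apply (HB (fun _ => 0)); intros j Hj; lra]. }
    assert (Hd2 : 0 < d ^ 2) by (apply pow_lt; exact Hd).
    destruct (INR_archimed (d ^ 2 * eps) (8 * B)) as [N0 HN0]; [nra|].
    set (N := S N0); assert (HN : 0 < INR N) by (apply lt_0_INR; unfold N; lia).
    assert (HNB : 8 * B <= INR N * (d ^ 2 * eps)) by (unfold N; rewrite S_INR; nra).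
    set (x := fun k => 2 * INR k / INR N - 1).
    assert (Hx : forall k, (k <= N)%nat -> -1 <= x k <= 1).
    { intros k Hk; unfold x; apply le_INR in Hk; pose proof (pos_INR k).
      assert (H1 : 0 <= 2 * INR k / INR N) by (apply Rle_mult_inv_pos; lra).
      assert (H2 : 2 * INR k / INR N <= 2).
      { apply (Rmult_le_reg_r (INR N)); [exact HN|].
        replace (2 * INR k / INR N * INR N) with (2 * INR k) by (field; lra); lra. }
      lra. }
    assert (HP : forall k, exists P, is_poly n P /\ ((k <= N)%nat ->
      forall q, in_cube n q -> Rabs (P q - f (scons (x k) q)) <= eps / 2)).
    { intro k; destruct (classic (k <= N)%nat) as [Hk|Hk];
        [|exists (fun _ => 0); split; [apply is_poly_const|contradiction]].
      destruct (IH (fun q => f (scons (x k) q)) B) with (eps := eps / 2) as (P & HP & HPf).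
      - intros q Hq; apply HB, in_cube_scons; [apply Hx, Hk|exact Hq].
      - intros e He; destruct (Uf e He) as (d' & Hd' & H); exists d'; split; [exact Hd'|].
        intros q q' Hq Hq' Hqq; apply H; try (apply in_cube_scons; [apply Hx, Hk|assumption]).
        intros [|j] Hj; simpl; [|apply Hqq; lia].
        replace (x k - x k) with 0 by ring; rewrite Rabs_R0; lra.
      - lra.
      - exists P; auto. }
    set (P := fun k => proj1_sig (constructive_indefinite_description _ (HP k))).
    assert (PP : forall k, is_poly n (P k))
      by (intro k; exact (proj1 (proj2_sig (constructive_indefinite_description _ (HP k))))).
    assert (HPf : forall k, (k <= N)%nat -> forall q, in_cube n q ->
      Rabs (P k q - f (scons (x k) q)) <= eps / 2)
      by (intro k; exact (proj2 (proj2_sig (constructive_indefinite_description _ (HP k))))).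
    exists (fun q => bernstein N (fun k => P k (fun j => q (S j))) (/ 2 * (q 0%nat + 1))); split.
    + apply (is_poly_bernstein (S n) N (fun q => / 2 * (q 0%nat + 1)))
        with (P := fun k q => P k (fun j => q (S j))).
      * apply is_poly_mul; [apply is_poly_const|].
        apply is_poly_add; [apply is_poly_coord; lia|apply is_poly_const].
      * intro k; apply is_poly_shift, PP.
    + intros q Hq; set (t := / 2 * (q 0%nat + 1)).
      assert (Hq0 : -1 <= q 0%nat <= 1) by (apply Hq; lia).
      assert (Ht : 0 <= t <= 1) by (unfold t; lra).
      (* Near or far, a node at distance [u] from [q 0] has error at most
         [eps / 4 + 2 B (u / d) ^ 2]. As [x k - q 0 = 2 / N * (k - N t)], [b] rescales this to the
         index [k]; the choice of [N] gives [b N <= eps], and [t (1 - t) <= 1 / 4] leaves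
         [eps / 4]. *)
      set (b := 2 * B / d ^ 2 * (2 / INR N) ^ 2).
      assert (Hb : 0 <= b).
      { unfold b; apply Rmult_le_pos; [apply Rle_mult_inv_pos; lra|apply pow2_ge_0]. }
      eapply Rle_trans.
      * apply (bernstein_error N t (f q) (eps / 2 + eps / 4) b Ht) with (c := INR N * t).
        intros k Hk; set (q' := fun j => q (S j)).
        assert (Hq' : in_cube n q') by (intros j Hj; apply Hq; lia).
        assert (Hsc : in_cube (S n) (scons (x k) q'))
          by (apply in_cube_scons; [apply Hx, Hk|exact Hq']).
        replace (P k q' - f q)
          with ((P k q' - f (scons (x k) q')) + (f (scons (x k) q') - f q)) by ring.
        eapply Rle_trans; [apply Rabs_triang|].
        rewrite Rplus_assoc; apply Rplus_le_compat; [apply HPf; assumption|].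
        assert (Eb : b * (INR k - INR N * t) ^ 2 = 2 * B * ((x k - q 0%nat) / d) ^ 2).
        { unfold b, x, t; field; lra. }
        rewrite Eb.
        destruct (Rle_or_lt (Rabs (x k - q 0%nat)) d) as [Hle|Hlt].
        -- assert (H : Rabs (f (scons (x k) q') - f q) <= eps / 4).
           { apply Hdf; [exact Hsc|exact Hq|]; intros [|j] Hj; simpl; [exact Hle|].
             unfold q'; replace (q (S j) - q (S j)) with 0 by ring; rewrite Rabs_R0; lra. }
           pose proof (pow2_ge_0 ((x k - q 0%nat) / d)); nra.
        -- assert (H : Rabs (f (scons (x k) q') - f q) <= 2 * B).
           { unfold Rminus; eapply Rle_trans; [apply Rabs_triang|]; rewrite Rabs_Ropp.
             assert (H1 := HB _ Hsc); assert (H2 := HB _ Hq); lra. }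
           assert (H1 : 1 <= ((x k - q 0%nat) / d) ^ 2).
           { rewrite <- (pow2_abs ((x k - q 0%nat) / d)); apply pow_R1_Rle.
             unfold Rdiv; rewrite Rabs_mult, (Rabs_pos_eq (/ d))
               by (apply Rlt_le, Rinv_0_lt_compat; exact Hd).
             apply (Rmult_le_reg_r d); [exact Hd|].
             replace (Rabs (x k - q 0%nat) * / d * d) with (Rabs (x k - q 0%nat)) by (field; lra).
             lra. }
           apply (Rmult_le_compat_l (2 * B)) in H1; lra.
      * replace (INR N * t - INR N * t) with 0 by ring.
        assert (Hvar : t * (1 - t) <= / 4) by (pose proof (pow2_ge_0 (t - / 2)); lra).
        assert (HbN : b * INR N <= eps).
        { unfold b; apply (Rmult_le_reg_r (d ^ 2 * INR N)); [nra|].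
          replace (2 * B / d ^ 2 * (2 / INR N) ^ 2 * INR N * (d ^ 2 * INR N)) with (8 * B)
            by (field; lra).
          nra. }
        assert (HbN0 : 0 <= b * INR N) by nra.
        replace (b * (0 ^ 2 + INR N * t * (1 - t))) with (b * INR N * (t * (1 - t))) by ring.
        nra.
Qed.

(** * Roots of monic polynomials *)

Definition root_dist2 (x y : R) (ab : R * R) : R := (x - fst ab) ^ 2 + (y - snd ab) ^ 2.

Definition cpoly_Re (c : nat -> R) (m : nat) (x y : R) : R :=
  sumR m (fun k => c k * fst (cpow x y k)).
Definition cpoly_Im (c : nat -> R) (m : nat) (x y : R) : R :=
  sumR m (fun k => c k * snd (cpow x y k)).

Lemma two_squares_identity (a b c d : R) :
  (a * c - b * d) ^ 2 + (a * d + b * c) ^ 2 = (a ^ 2 + b ^ 2) * (c ^ 2 + d ^ 2).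
Proof. ring. Qed.

(** The MathComp names and notations stay inside this module; [monic_splits], used outside it,
    speaks of pairs of reals only. *)
Module ComplexRoots.
Import mathcomp.boot.ssreflect mathcomp.boot.ssrfun mathcomp.boot.ssrbool mathcomp.boot.eqtype
  mathcomp.boot.ssrnat mathcomp.boot.seq mathcomp.boot.fintype mathcomp.boot.bigop.
Import mathcomp.algebra.ssralg mathcomp.algebra.poly mathcomp.real_closed.complex
  mathcomp.reals_stdlib.Rstruct.
Import GRing.Theory.
Local Open Scope complex_scope.
Local Open Scope R_scope.

Definition sqnorm (z : R[i]) : R := let: a +i* b := z in a ^ 2 + b ^ 2.

Lemma sqnormM (z w : R[i]) : sqnorm (z * w)%R = sqnorm z * sqnorm w.
Proof. case: z => a b; case: w => c d; exact: two_squares_identity. Qed.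

Lemma cpowE (x y : R) (k : nat) :
  ((x +i* y : R[i]) ^+ k)%R = (fst (cpow x y k)) +i* (snd (cpow x y k)).
Proof.
elim: k => [|k IH] //=; rewrite exprSr IH.
by case: (cpow x y k).
Qed.

Lemma cpolyE (c : nat -> R) (m : nat) (x y : R) :
  (\sum_(k < m) (c k)%:C * (x +i* y : R[i]) ^+ k)%R = cpoly_Re c m x y +i* cpoly_Im c m x y.
Proof.
elim: m => [|m IH]; first by rewrite big_ord0.
rewrite big_ord_recr /= IH cpowE; rewrite /cpoly_Re /cpoly_Im /=.
by congr (_ +i* _); rewrite /= ?mul0r ?subr0 ?addr0.
Qed.

(** The complex numbers are algebraically closed, and the multiplicative [sqnorm] turns the linear
    factorization into a product of squared distances. Roots are listed with multiplicity, whence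
    the length [m]. *)
Lemma monic_splits (m : nat) (c : nat -> R) : c m = 1 ->
  exists l : list (R * R), length l = m /\
    forall x y, cpoly_Re c (S m) x y ^ 2 + cpoly_Im c (S m) x y ^ 2
                = fold_right (fun ab acc => root_dist2 x y ab * acc) 1 l.
Proof.
move=> cm.
pose p : {poly R[i]} := (\poly_(k < m.+1) (c k)%:C)%R.
have szp : size p = m.+1 by rewrite size_poly_eq // cm; apply/eqP => -[] /R1_neq_R0.
have lcp : lead_coef p = 1%R by rewrite lead_coefE szp coef_poly ltnSn cm.
have [r Dp] := closed_field_poly_normal p.
rewrite lcp scale1r in Dp.
exists (map (fun z : R[i] => (complex.Re z, complex.Im z)) r); split.
  have : size p = (size r).+1 by rewrite Dp size_prod_XsubC.
  by rewrite szp => -[->]; elim: (r) => //= a s ->.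
move=> x y; have := cpolyE c m.+1 x y.
rewrite -(horner_poly m.+1 (fun k => (c k)%:C)) -/p Dp => E.
have -> : cpoly_Re c (S m) x y ^ 2 + cpoly_Im c (S m) x y ^ 2
   = sqnorm (cpoly_Re c (S m) x y +i* cpoly_Im c (S m) x y) by [].
rewrite -E; elim: (r) => [|z s IH] /=.
  by rewrite big_nil hornerC; change (1 ^ 2 + 0 ^ 2 = 1); ring.
rewrite big_cons hornerM sqnormM IH hornerXsubC.
by case: z.
Qed.
End ComplexRoots.

Lemma sum_squares_eq_0 (a b : R) : a ^ 2 + b ^ 2 = 0 -> a = 0 /\ b = 0.
Proof. rewrite <- !Rsqr_pow2; apply Rplus_sqr_eq_0. Qed.

Lemma monic_splits_root (m : nat) (c : nat -> R) (l : list (R * R)) :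
  (forall x y, cpoly_Re c (S m) x y ^ 2 + cpoly_Im c (S m) x y ^ 2
               = fold_right (fun ab acc => root_dist2 x y ab * acc) 1 l) ->
  forall x y, (cpoly_Re c (S m) x y = 0 /\ cpoly_Im c (S m) x y = 0) <-> In (x, y) l.
Proof.
  intros E x y; specialize (E x y).
  assert (H : fold_right (fun ab acc => root_dist2 x y ab * acc) 1 l = 0 <-> In (x, y) l).
  { clear E; induction l as [|[a b] l IH]; simpl; [split; [lra|tauto]|].
    rewrite <- IH; unfold root_dist2; simpl fst; simpl snd; split.
    - intro H; apply Rmult_integral in H as [H|H]; [left|right; exact H].
      apply sum_squares_eq_0 in H as [Hx Hy]; f_equal; lra.
    - intros [H|H]; [injection H as -> ->; ring|rewrite H; ring]. }
  rewrite <- H, <- E; split; [intros [-> ->]; ring|intro H0].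
  apply sum_squares_eq_0, H0.
Qed.

(** If all [m] squared distances exceeded [D], their product would exceed [D ^ m]. *)
Lemma monic_root_near (m : nat) (c : nat -> R) (x y D : R) : (1 <= m)%nat -> c m = 1 -> 0 <= D ->
  cpoly_Re c (S m) x y ^ 2 + cpoly_Im c (S m) x y ^ 2 <= D ^ m ->
  exists a b, cpoly_Re c (S m) a b = 0 /\ cpoly_Im c (S m) a b = 0 /\
    (x - a) ^ 2 + (y - b) ^ 2 <= D.
Proof.
  intros Hm Hc HD H; destruct (ComplexRoots.monic_splits m c Hc) as (l & Hl & E).
  cut (exists ab, In ab l /\ root_dist2 x y ab <= D).
  { intros ([a b] & Hin & Hab); exists a, b.
    apply (monic_splits_root m c l E) in Hin; unfold root_dist2 in Hab; tauto. }
  apply NNPP; intro Hno.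
  assert (Hfar : forall ab, In ab l -> D < root_dist2 x y ab).
  { intros ab Hab; apply Rnot_le_lt; intro Hle; apply Hno; exists ab; auto. }
  rewrite E in H; clear E Hno Hc c; subst m.
  assert (Hge : forall k, (forall ab, In ab k -> D < root_dist2 x y ab) ->
    D ^ length k <= fold_right (fun ab acc => root_dist2 x y ab * acc) 1 k).
  { induction k as [|ab k IH]; intro Hk; simpl; [lra|].
    apply Rmult_le_compat; [exact HD|apply pow_le, HD| |apply IH; intros; apply Hk; right; assumption].
    apply Rlt_le, Hk; left; reflexivity. }
  destruct l as [|ab l]; simpl in *; [lia|].
  assert (H1 := Hge l ltac:(intros; apply Hfar; auto)); assert (H2 := Hfar ab ltac:(auto)).
  assert (H3 : 0 <= D ^ length l) by (apply pow_le, HD).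
  (* When [D ^ length l] is positive, the first factor alone makes the inequality strict; when it is
     zero, positivity of the remaining product is used. *)
  destruct (Rle_lt_or_eq_dec _ _ H3) as [H4|H4]; [nra|].
  assert (Hpos : 0 < fold_right (fun ab acc => root_dist2 x y ab * acc) 1 l).
  { clear - Hfar HD.
    assert (Hf : forall ab, In ab l -> D < root_dist2 x y ab) by (intros; apply Hfar; auto).
    clear Hfar; induction l as [|b l IH]; simpl in *; [lra|].
    apply Rmult_lt_0_compat; [specialize (Hf b ltac:(auto)); lra|apply IH; intros; apply Hf; auto]. }
  nra.
Qed.

Lemma list_fst_max (l : list (R * R)) : l <> nil ->
  exists ab, In ab l /\ forall cd, In cd l -> fst cd <= fst ab.
Proof.
  induction l as [|a l IH]; [tauto|intros _].
  destruct l as [|b l]; [exists a; split; [left; reflexivity|intros cd [<-|[]]; lra]|].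
  destruct IH as (ab & Hab & Hmax); [discriminate|].
  destruct (Rle_or_lt (fst a) (fst ab)) as [Hle|Hlt].
  - exists ab; split; [right; exact Hab|intros cd [<-|Hcd]; [exact Hle|apply Hmax, Hcd]].
  - exists a; split; [left; reflexivity|].
    intros cd [<-|Hcd]; [lra|specialize (Hmax cd Hcd); lra].
Qed.

Lemma abscissa_spec (m : nat) (pk : nat -> mpoly) (q : nat -> R) :
  (1 <= m)%nat -> mp_eval (pk m) q = 1 -> is_abscissa m pk q (abscissa m pk q).
Proof.
  intros Hm Hpm; unfold abscissa; apply epsilon_spec.
  destruct (ComplexRoots.monic_splits m (fun k => mp_eval (pk k) q) Hpm) as (l & Hl & E).
  pose proof (monic_splits_root m (fun k => mp_eval (pk k) q) l E) as Hroot.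
  destruct (list_fst_max l) as ([a b] & Hab & Hmax); [intros ->; simpl in Hl; lia|].
  exists a; split; [exists b; apply Hroot, Hab|].
  intros x y Hxy; apply (Hmax (x, y)), Hroot, Hxy.
Qed.

Lemma qxy_lt (n j : nat) (q : nat -> R) (x y : R) : (j < n)%nat -> qxy n q x y j = q j.
Proof. intro Hj; unfold qxy; apply Nat.ltb_lt in Hj; rewrite Hj; reflexivity. Qed.

Lemma qxy_n (n : nat) (q : nat -> R) (x y : R) : qxy n q x y n = x.
Proof. unfold qxy; rewrite Nat.ltb_irrefl, Nat.eqb_refl; reflexivity. Qed.

Lemma qxy_Sn (n : nat) (q : nat -> R) (x y : R) : qxy n q x y (S n) = y.
Proof.
  unfold qxy; destruct (Nat.ltb_spec (S n) n); [lia|].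
  destruct (Nat.eqb_spec (S n) n); [lia|reflexivity].
Qed.

(** * Uniform continuity of the abscissa *)

Section Abscissa.
Context (n m : nat) (pk : nat -> mpoly) (Hm : (1 <= m)%nat).
Context (Hpk : forall k, (k <= m)%nat -> mp_vars_lt (pk k) n).
Context (Hpm : forall q, mp_eval (pk m) q = 1).

Lemma zRe_qxy (q : nat -> R) (x y : R) : zRe n m pk (qxy n q x y) = pRe m pk q x y.
Proof.
  unfold zRe, pRe; rewrite qxy_n, qxy_Sn; apply sumR_ext; intros k Hk; f_equal.
  apply mp_eval_ext with n; [apply Hpk; lia|intros; apply qxy_lt; assumption].
Qed.

Lemma zIm_qxy (q : nat -> R) (x y : R) : zIm n m pk (qxy n q x y) = pIm m pk q x y.
Proof.
  unfold zIm, pIm; rewrite qxy_n, qxy_Sn; apply sumR_ext; intros k Hk; f_equal.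
  apply mp_eval_ext with n; [apply Hpk; lia|intros; apply qxy_lt; assumption].
Qed.

(** The algebraic certificate for [C - r] is evaluated at a root, where every generator is
    nonnegative. *)
Lemma roots_bounded : exists C, 0 <= C /\
  forall q x y, in_cube n q -> is_root m pk q x y -> x ^ 2 + y ^ 2 <= C.
Proof.
  destruct (r_bounded n m pk Hm Hpk Hpm) as [C HC].
  exists (Rabs C); split; [apply Rabs_pos|]; intros q x y Hq [HR HI].
  apply Rle_trans with C; [|apply Rle_abs].
  assert (H : 0 <= C - (qxy n q x y n ^ 2 + qxy n q x y (S n) ^ 2)).
  { apply (qmod_nonneg _ _ _ (qxy n q x y)) in HC; [exact HC|].
    intros g [|j Hj| | | |]; rewrite ?zRe_qxy, ?zIm_qxy, ?HR, ?HI; try lra.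
    rewrite qxy_lt by exact Hj; specialize (Hq j Hj); nra. }
  rewrite qxy_n, qxy_Sn in H; lra.
Qed.

Lemma coefs_ucont (K : nat) : (K <= S m)%nat -> forall eps, 0 < eps ->
  exists delta, 0 < delta /\ forall q q', in_cube n q -> in_cube n q' ->
    (forall j, (j < n)%nat -> Rabs (q j - q' j) <= delta) ->
    forall k, (k < K)%nat -> Rabs (mp_eval (pk k) q - mp_eval (pk k) q') <= eps.
Proof.
  induction K as [|K IH]; intros HK eps Heps; [exists 1; split; [lra|intros; lia]|].
  destruct (IH ltac:(lia) eps Heps) as (d & Hd & H).
  destruct (is_poly_cube_ucont n (mp_eval (pk K))) as [U _]; [apply is_poly_mp_eval, Hpk; lia|].
  destruct (U eps Heps) as (d' & Hd' & H').
  exists (Rmin d d'); split; [apply Rmin_glb_lt; assumption|]; intros q q' Hq Hq' Hqq k Hk.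
  destruct (Nat.eq_dec k K) as [->|Hne].
  - apply H'; try assumption; intros j Hj; eapply Rle_trans; [apply Hqq, Hj|apply Rmin_r].
  - apply H; try assumption; [|lia].
    intros j Hj; eapply Rle_trans; [apply Hqq, Hj|apply Rmin_l].
Qed.

(* A root [s] of [p(q, .)] satisfies [|p(q', s)| <= eps ^ m] for [q'] near [q];
   as [|p(q', s)|] is the product of the distances from [s] to the [m] roots
   of [p(q', .)], one of these roots is within [eps] of [s]. *)
Lemma abscissa_ucont : cube_ucont n (abscissa m pk).
Proof.
  intros eps Heps; destruct roots_bounded as (C & HC & Hroots).
  set (W := (1 + C) ^ m).
  assert (HW : 1 <= W) by (apply pow_R1_Rle; lra).
  assert (Hm0 := pos_INR m).
  (* [W] bounds the [|s ^ k|], so [m + 1] coefficient errors of size [tau] change each part of [p]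
     by at most [eps ^ m / 2], and the squares add up to at most [(eps ^ 2) ^ m]. *)
  set (tau := eps ^ m / (2 * INR (S m) * W)).
  assert (Hem : 0 < eps ^ m) by (apply pow_lt, Heps).
  assert (HSm : 1 <= INR (S m)) by (rewrite S_INR; lra).
  assert (Htau : 0 < tau) by (apply Rdiv_lt_0_compat; nra).
  destruct (coefs_ucont (S m) (le_n _) tau Htau) as (d & Hd & Hcoef).
  exists d; split; [exact Hd|].
  assert (half : forall q q', in_cube n q -> in_cube n q' ->
    (forall j, (j < n)%nat -> Rabs (q j - q' j) <= d) ->
    abscissa m pk q - eps <= abscissa m pk q').
  { intros q q' Hq Hq' Hqq.
    destruct (abscissa_spec m pk q Hm (Hpm q)) as [[y Hy] _].
    destruct (abscissa_spec m pk q' Hm (Hpm q')) as [_ Hmax].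
    set (x := abscissa m pk q) in *.
    assert (Hxy := Hroots q x y Hq Hy); destruct Hy as [HR HI].
    assert (Hpow : forall k, (k < S m)%nat ->
      fst (cpow x y k) ^ 2 + snd (cpow x y k) ^ 2 <= W ^ 2).
    { intros k Hk; rewrite cpow_norm.
      apply Rle_trans with ((1 + C) ^ k); [apply pow_incr; nra|].
      apply Rle_trans with W; [apply Rle_pow; [lra|lia]|nra]. }
    assert (Hval : forall u : nat -> R, (forall k, (k < S m)%nat -> u k ^ 2 <= W ^ 2) ->
      sumR (S m) (fun k => mp_eval (pk k) q * u k) = 0 ->
      Rabs (sumR (S m) (fun k => mp_eval (pk k) q' * u k)) <= eps ^ m / 2).
    { intros u Hu H0.
      replace (sumR (S m) (fun k => mp_eval (pk k) q' * u k))
        with (sumR (S m) (fun k => mp_eval (pk k) q' * u k)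
              - sumR (S m) (fun k => mp_eval (pk k) q * u k)) by (rewrite H0; ring).
      rewrite <- sumR_minus.
      replace (eps ^ m / 2) with (INR (S m) * (tau * W)) by (unfold tau; field; lra).
      apply sumR_Rabs; intros k Hk.
      replace (mp_eval (pk k) q' * u k - mp_eval (pk k) q * u k)
        with ((mp_eval (pk k) q' - mp_eval (pk k) q) * u k) by ring.
      rewrite Rabs_mult, Rabs_minus_sym.
      apply Rmult_le_compat; try apply Rabs_pos; [apply Hcoef; assumption|].
      rewrite <- (Rabs_pos_eq W) by lra; apply Rsqr_le_abs_0; rewrite !Rsqr_pow2; apply Hu, Hk. }
    assert (HR' := Hval (fun k => fst (cpow x y k))
      ltac:(intros k Hk; specialize (Hpow k Hk); pose proof (pow2_ge_0 (snd (cpow x y k))); lra) HR).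
    assert (HI' := Hval (fun k => snd (cpow x y k))
      ltac:(intros k Hk; specialize (Hpow k Hk); pose proof (pow2_ge_0 (fst (cpow x y k))); lra) HI).
    destruct (monic_root_near m (fun k => mp_eval (pk k) q') x y (eps ^ 2))
      as (a & b & Ha & Hb & Hab); [exact Hm|apply Hpm|apply pow2_ge_0| |].
    - rewrite <- pow_mult, Nat.mul_comm, pow_mult.
      unfold cpoly_Re, cpoly_Im.
      set (A := sumR (S m) (fun k => mp_eval (pk k) q' * fst (cpow x y k))) in *.
      set (B := sumR (S m) (fun k => mp_eval (pk k) q' * snd (cpow x y k))) in *.
      rewrite <- (pow2_abs A), <- (pow2_abs B).
      pose proof (Rabs_pos A); pose proof (Rabs_pos B); nra.
    - assert (Hax : x - a <= eps).
      { apply Rnot_lt_le; intro Hlt; pose proof (pow2_ge_0 (y - b)); nra. }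
      specialize (Hmax a b (conj Ha Hb)); lra. }
  intros q q' Hq Hq' Hqq; apply Rabs_le.
  assert (H1 := half q q' Hq Hq' Hqq).
  assert (H2 := half q' q Hq' Hq ltac:(intros j Hj; rewrite Rabs_minus_sym; apply Hqq, Hj)).
  lra.
Qed.

Lemma abscissa_bounded : exists B, forall q, in_cube n q -> Rabs (abscissa m pk q) <= B.
Proof.
  destruct roots_bounded as (C & HC & Hroots); exists (1 + C); intros q Hq.
  destruct (abscissa_spec m pk q Hm (Hpm q)) as [[y Hy] _].
  specialize (Hroots q _ y Hq Hy); pose proof (pow2_ge_0 y).
  apply Rabs_le; nra.
Qed.

(** * From the quadratic module to feasible points of the program *)

Definition certificate (f : fn) (s0 : list mpoly) (sj : nat -> list mpoly)
    (tRe tIm : mpoly) : Prop :=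
  Forall (fun P => mp_vars_lt P (n + 2)) s0 /\
  (forall j, (j < n)%nat -> Forall (fun P => mp_vars_lt P (n + 2)) (sj j)) /\
  mp_vars_lt tRe (n + 2) /\ mp_vars_lt tIm (n + 2) /\
  forall z, f z = sos_eval s0 z + sumR n (fun j => sos_eval (sj j) z * (1 - z j ^ 2))
                  + mp_eval tRe z * zRe n m pk z + mp_eval tIm z * zIm n m pk z.

Lemma sos_eval_app (L L' : list mpoly) (z : nat -> R) :
  sos_eval (L ++ L') z = sos_eval L z + sos_eval L' z.
Proof.
  unfold sos_eval; induction L as [|P L IH]; cbn [app fold_right]; [ring|rewrite IH; ring].
Qed.

Lemma qmod_certificate (f : fn) : qmod (n + 2) (abscissa_gens n m pk) f ->
  exists s0 sj tRe tIm, certificate f s0 sj tRe tIm.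
Proof.
  assert (Z0 : forall z, sumR n (fun j => sos_eval nil z * (1 - z j ^ 2)) = 0).
  { intro z; rewrite (sumR_ext _ _ (fun _ => 0)), sumR_const; [ring|intros; unfold sos_eval; simpl; ring]. }
  assert (S1 : forall P z, sos_eval [P] z = mp_eval P z ^ 2) by (intros; unfold sos_eval; simpl; ring).
  assert (nilV : mp_vars_lt nil (n + 2)) by constructor.
  assert (ideal : forall t g, is_poly (n + 2) t -> forall f,
    (forall z, f z = t z * g z) -> (g = zRe n m pk \/ g = zIm n m pk) ->
    exists s0 sj tRe tIm, certificate f s0 sj tRe tIm).
  { intros t g (P & HP & EP) h Eh [-> | ->];
      [exists nil, (fun _ => nil), P, nil|exists nil, (fun _ => nil), nil, P];
      (repeat split; try assumption; try constructor);
      intro z; rewrite Eh, EP, Z0; change (sos_eval nil z) with 0; change (mp_eval nil z) with 0;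
      ring. }
  induction 1 as [a g f Ha Hg E
    |f g h _ (s0 & sj & tR & tI & H0 & Hj & HR & HI & Ef)
         _ (s0' & sj' & tR' & tI' & H0' & Hj' & HR' & HI' & Eg) E].
  - assert (Pa2 : is_poly (n + 2) (fun z => a z ^ 2)) by (apply is_poly_pow, Ha).
    destruct Hg as [|j Hj| | | |].
    + destruct Ha as (P & HP & EP); exists [P], (fun _ => nil), nil, nil.
      repeat split; try assumption; try (constructor; try assumption; constructor).
      intro z; rewrite E, EP, Z0, S1; change (mp_eval nil z) with 0; ring.
    + destruct Ha as (P & HP & EP).
      exists nil, (fun i => if Nat.eqb i j then [P] else nil), nil, nil.
      repeat split; try assumption; try constructor.
      * intros i Hi; destruct (Nat.eqb i j); repeat constructor; assumption.
      * intro z; rewrite E, EP.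
        (* Only the index [j] contributes; the upper limit is freed from [n] for the induction. *)
        assert (Hsum : forall k, sumR k (fun i => sos_eval (if Nat.eqb i j then [P] else nil) z
                                        * (1 - z i ^ 2))
          = if Nat.ltb j k then mp_eval P z ^ 2 * (1 - z j ^ 2) else 0).
        { induction k as [|k IH]; [reflexivity|].
          change (sumR (S k) ?u) with (sumR k u + u k); cbv beta; rewrite IH.
          destruct (Nat.eqb_spec k j) as [->|Hne].
          - rewrite Nat.ltb_irrefl, (proj2 (Nat.ltb_lt j (S j))) by lia.
            rewrite S1; ring.
          - replace (Nat.ltb j (S k)) with (Nat.ltb j k)
              by (destruct (Nat.ltb_spec j k), (Nat.ltb_spec j (S k)); lia || reflexivity).
            change (sos_eval nil z) with 0; ring. }
        rewrite Hsum, (proj2 (Nat.ltb_lt j n) Hj).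
        change (sos_eval nil z) with 0; change (mp_eval nil z) with 0; ring.
    + apply (ideal _ _ Pa2 f E); auto.
    + apply (ideal _ (zRe n m pk) (is_poly_opp _ _ Pa2)); [intro z; rewrite E; ring|auto].
    + apply (ideal _ _ Pa2 f E); auto.
    + apply (ideal _ (zIm n m pk) (is_poly_opp _ _ Pa2)); [intro z; rewrite E; ring|auto].
  - exists (s0 ++ s0'), (fun j => sj j ++ sj' j), (tR ++ tR'), (tI ++ tI').
    split; [apply Forall_app; auto|split; [intros j Hjn; apply Forall_app; auto|]].
    split; [apply Forall_app; auto|split; [apply Forall_app; auto|]].
    intro z; rewrite E, Ef, Eg, sos_eval_app, !mp_eval_app.
    assert (Hsum : forall k, sumR k (fun j => sos_eval (sj j ++ sj' j) z * (1 - z j ^ 2))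
      = sumR k (fun j => sos_eval (sj j) z * (1 - z j ^ 2))
        + sumR k (fun j => sos_eval (sj' j) z * (1 - z j ^ 2))).
    { induction k as [|k IH]; [simpl; ring|].
      change (sumR (S k) ?u) with (sumR k u + u k); cbv beta; rewrite IH, sos_eval_app; ring. }
    rewrite Hsum; ring.
Qed.

Lemma mp_deg_le_exists (P : mpoly) : exists D, forall k, (D <= k)%Z -> mp_deg_le P k.
Proof.
  induction P as [|mo P [D IH]]; [exists 0%Z; constructor|].
  exists (Z.max D (Z.of_nat (list_sum (snd mo)))); intros k Hk; constructor; [lia|apply IH; lia].
Qed.

Lemma sos_in_exists (N : nat) (L : list mpoly) : Forall (fun P => mp_vars_lt P N) L ->
  exists D, forall k, (D <= k)%Z -> sos_in N k L.
Proof.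
  induction 1 as [|P L HP HL [D IH]]; [exists 0%Z; constructor|].
  destruct (mp_deg_le_exists P) as [D' HD']; exists (Z.max D D'); intros k Hk.
  constructor; [split; [exact HP|apply HD'; lia]|apply IH; lia].
Qed.

Lemma sos_in_family (N K : nat) (sj : nat -> list mpoly) :
  (forall j, (j < K)%nat -> Forall (fun P => mp_vars_lt P N) (sj j)) ->
  exists D, forall k, (D <= k)%Z -> forall j, (j < K)%nat -> sos_in N k (sj j).
Proof.
  induction K as [|K IH]; intro H; [exists 0%Z; intros; lia|].
  destruct IH as [D HD]; [intros; apply H; lia|].
  destruct (sos_in_exists N (sj K)) as [D' HD']; [apply H; lia|].
  exists (Z.max D D'); intros k Hk j Hj.
  destruct (Nat.eq_dec j K) as [->|Hne]; [apply HD'; lia|apply HD; lia].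
Qed.

Lemma certificate_feasible (w : mpoly) : mp_vars_lt w n ->
  qmod (n + 2) (abscissa_gens n m pk) (fun z => mp_eval w z - z n) ->
  exists d1, forall d, (d1 <= d)%nat -> feasible n m pk d w.
Proof.
  intros Hw H; apply qmod_certificate in H as (s0 & sj & tR & tI & H0 & Hj & HR & HI & E).
  destruct (mp_deg_le_exists w) as [Dw HDw]; destruct (sos_in_exists _ _ H0) as [D0 HD0].
  destruct (sos_in_family _ _ _ Hj) as [Dj HDj].
  destruct (mp_deg_le_exists tR) as [DR HDR]; destruct (mp_deg_le_exists tI) as [DI HDI].
  (* Exceeds each threshold even after the losses [- 1] and [- m] in the degree bounds; the absolute
     values keep the sum above every single term. *)
  exists (Z.to_nat (Z.abs Dw + Z.abs D0 + Z.abs Dj + Z.abs DR + Z.abs DI + Z.of_nat m + 1)).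
  intros d Hd; split; [split; [exact Hw|apply HDw; lia]|].
  exists s0, sj, tR, tI; split; [apply HD0; lia|split; [intros; apply HDj; [lia|assumption]|]].
  split; [split; [exact HR|apply HDR; lia]|split; [split; [exact HI|apply HDI; lia]|]].
  intros q x y; specialize (E (qxy n q x y)); rewrite zRe_qxy, zIm_qxy, qxy_n in E.
  rewrite E; do 3 f_equal; apply sumR_ext; intros j Hjn; rewrite qxy_lt by exact Hjn; reflexivity.
Qed.

Lemma feasible_above_abscissa (d : nat) (w : mpoly) (q : nat -> R) :
  feasible n m pk d w -> in_cube n q -> abscissa m pk q <= mp_eval w q.
Proof.
  intros ([Hw _] & s0 & sj & tR & tI & _ & _ & _ & _ & E) Hq.
  destruct (abscissa_spec m pk q Hm (Hpm q)) as [[y [HR HI]] _].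
  specialize (E q (abscissa m pk q) y); rewrite HR, HI in E.
  rewrite (mp_eval_ext n w _ q Hw) in E by (intros; apply qxy_lt; assumption).
  assert (Hsos : forall L z, 0 <= sos_eval L z).
  { intros L z; unfold sos_eval; induction L as [|P L IH]; simpl; [lra|].
    pose proof (pow2_ge_0 (mp_eval P z)); simpl in *; lra. }
  assert (Hsum : 0 <= sumR n (fun j => sos_eval (sj j) (qxy n q (abscissa m pk q) y)
                                      * (1 - q j ^ 2))).
  { apply Rle_trans with (sumR n (fun _ => 0)); [rewrite sumR_const; lra|].
    apply sumR_le; intros j Hj; apply Rmult_le_pos; [apply Hsos|specialize (Hq j Hj); nra]. }
  pose proof (Hsos s0 (qxy n q (abscissa m pk q) y)); lra.
Qed.

Lemma feasible_near_abscissa (eps : R) : 0 < eps ->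
  exists w d1, mp_vars_lt w n /\
    (forall q, in_cube n q -> mp_eval w q <= abscissa m pk q + eps) /\
    forall d, (d1 <= d)%nat -> feasible n m pk d w.
Proof.
  intro Heps; destruct abscissa_bounded as [B HB].
  (* Raised by [eps / 2], this approximation lies between [a + eps / 4] and [a + 3 eps / 4]; the
     strict lower bound is what [putinar] requires. *)
  destruct (cube_weierstrass n _ B HB abscissa_ucont (eps / 4)) as (g & Hg & Hga); [lra|].
  destruct (is_poly_add _ _ _ Hg (is_poly_const n (eps / 2))) as (w & Hw & Ew).
  assert (Hwa : forall q, in_cube n q ->
    abscissa m pk q < mp_eval w q <= abscissa m pk q + eps).
  { intros q Hq; rewrite <- Ew; specialize (Hga q Hq).
    unfold Rabs in Hga; destruct (Rcase_abs (g q - abscissa m pk q)); lra. }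
  assert (Hq : qmod (n + 2) (abscissa_gens n m pk) (fun z => mp_eval w z - z n)).
  { apply putinar.
    - apply gens_one.
    - exact (abscissa_gens_poly n m pk Hm Hpk).
    - exact (abscissa_archimedean n m pk Hm Hpk Hpm).
    - apply is_poly_sub; [apply is_poly_le with n; [lia|apply is_poly_mp_eval, Hw]|].
      apply is_poly_coord; lia.
    (* The point [c] itself serves as the parameter [q], since the coefficients read only its first
       [n] coordinates; the next two coordinates form a root. *)
    - intros c Hc.
      assert (Hcube : in_cube n c).
      { intros j Hj; assert (H := Hc _ (gens_box n m pk j Hj)); simpl in H; split; nra. }
      assert (Hroot : is_root m pk c (c n) (c (S n))).
      { pose proof (Hc _ (gens_Re n m pk)) as H1; pose proof (Hc _ (gens_Re_opp n m pk)) as H2.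
        pose proof (Hc _ (gens_Im n m pk)) as H3; pose proof (Hc _ (gens_Im_opp n m pk)) as H4.
        simpl in *; unfold zRe, zIm in *; split; lra. }
      destruct (abscissa_spec m pk c Hm (Hpm c)) as [_ Hmax].
      specialize (Hmax _ _ Hroot); specialize (Hwa c Hcube); lra. }
  destruct (certificate_feasible w Hw Hq) as [d1 Hd1]; exists w, d1.
  split; [exact Hw|split; [intros q Hqc; apply Hwa, Hqc|exact Hd1]].
Qed.
End Abscissa.

(** * Convergence of the optimal values and of the near optimal solutions *)

Theorem theorem1
  (n m : nat) (Hn : (1 <= n)%nat) (Hm : (1 <= m)%nat)
  (pk : nat -> mpoly)
  (Hpk : forall k, (k <= m)%nat -> mp_vars_lt (pk k) n)
  (Hpm : forall q, mp_eval (pk m) q = 1)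
  (d0 : nat)
  (Hfeas : forall d, (d0 <= d)%nat -> exists w, feasible n m pk d w)
  (rho : nat -> R)
  (Hrho : forall d, (d0 <= d)%nat ->
     is_inf (fun r => exists w, feasible n m pk d w /\ r = cube_int n (mp_eval w)) (rho d))
  (v : nat -> mpoly)
  (Hv : forall d, (d0 <= d)%nat ->
     feasible n m pk d (v d) /\ cube_int n (mp_eval (v d)) <= rho d + 1 / INR d) :
  (forall d, (d0 <= d)%nat -> forall q, in_cube n q -> abscissa m pk q <= mp_eval (v d) q)
  /\ Un_cv (fun d => cube_int n (fun q => Rabs (mp_eval (v d) q - abscissa m pk q))) 0
  /\ Un_cv rho (cube_int n (abscissa m pk)).
Proof.
  assert (Ua := abscissa_ucont n m pk Hm Hpk Hpm).
  assert (Uw : forall w, mp_vars_lt w n -> cube_ucont n (mp_eval w))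
    by (intros w Hw; apply is_poly_cube_ucont, is_poly_mp_eval, Hw).
  set (I := cube_int n (abscissa m pk)).
  assert (Hlow : forall d w, feasible n m pk d w -> I <= cube_int n (mp_eval w)).
  { intros d w Hw; replace (cube_int n (mp_eval w)) with (cube_int n (mp_eval w) + 2 ^ n * 0) by ring.
    apply cube_int_le_add; [exact Ua|apply Uw, Hw|].
    intros q Hq; rewrite Rplus_0_r; apply (feasible_above_abscissa n m pk Hm Hpm d); assumption. }
  assert (Hrho_low : forall d, (d0 <= d)%nat -> I <= rho d).
  { intros d Hd; apply (Hrho d Hd); intros r (w & Hw & ->); apply (Hlow d), Hw. }
  assert (Hrho_up : forall eps, 0 < eps ->
    exists D, (d0 <= D)%nat /\ forall d, (D <= d)%nat -> rho d <= I + eps).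
  { intros eps Heps; assert (H2n : 0 < 2 ^ n) by (apply pow_lt; lra).
    (* The cube has volume [2 ^ n]. *)
    destruct (feasible_near_abscissa n m pk Hm Hpk Hpm (eps / 2 ^ n))
      as (w & d1 & Hw & Hwa & Hfe); [apply Rdiv_lt_0_compat; assumption|].
    exists (d0 + d1)%nat; split; [lia|]; intros d Hd.
    apply Rle_trans with (cube_int n (mp_eval w)).
    - apply (proj1 (Hrho d ltac:(lia))); exists w; split; [apply Hfe; lia|reflexivity].
    - replace eps with (2 ^ n * (eps / 2 ^ n)) by (field; lra).
      apply cube_int_le_add; [apply Uw, Hw|exact Ua|exact Hwa]. }
  split; [|split].
  - intros d Hd q Hq; apply (feasible_above_abscissa n m pk Hm Hpm d); [apply Hv, Hd|exact Hq].
  (* One third for the excess of [rho d] over the integral, one for the tolerance [1 / d]; the last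
     third makes the inequality strict. *)
  - intros eps Heps; destruct (Hrho_up (eps / 3)) as (D & HD & Hup); [lra|].
    destruct (INR_archimed (eps / 3) 1) as [D' HD']; [lra|].
    exists (S (D + D')); intros d Hd; destruct (Hv d ltac:(lia)) as [Hvf Hvi].
    rewrite cube_int_Rabs_sub;
      [|apply Uw, Hvf|exact Ua|intros; apply (feasible_above_abscissa n m pk Hm Hpm d); assumption].
    fold I; assert (H1 := Hlow d (v d) Hvf); assert (H2 := Hup d ltac:(lia)).
    assert (Hd0 : 0 < INR d) by (apply lt_0_INR; lia).
    assert (Hinv : 1 / INR d <= eps / 3).
    { apply (Rmult_le_reg_r (INR d)); [exact Hd0|].
      replace (1 / INR d * INR d) with 1 by (field; lra).
      assert (HDd : INR D' <= INR d) by (apply le_INR; lia); nra. }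
    unfold Rdist; rewrite Rminus_0_r, Rabs_pos_eq by lra; lra.
  - intros eps Heps; destruct (Hrho_up (eps / 2)) as (D & HD & Hup); [lra|].
    exists D; intros d Hd; assert (H1 := Hrho_low d ltac:(lia)); assert (H2 := Hup d Hd).
    unfold Rdist; rewrite Rabs_pos_eq by lra; lra.
Qed.
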